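(* Let $\Bbbk$ be a field and $n$ a positive integer. The dimension of the space of linear second syzygies of $S/\det_n^\perp$ is $$\beta_{3,4}=\frac{1}{192}(n-1)n^2(n+1)^2(n+2)(5n^2+5n-18)=6\binom{n+1}{4}\binom{n+3}{4}+9\binom{n+2}{4}^2.$$ The dimension of the space of linear second syzygies of $S/\operatorname{perm}_n^\perp$ is $$\beta_{3,4}=\frac{1}{192}(n-1)n^2(5n^5+25n^4+35n^3-85n^2+8n-84)=6\binom{n+1}{4}\binom{n+3}{4}+9\binom{n+2}{4}^2+2\binom{n}{2}\binom{n}{4}.$$
   Context: Let $R=\Bbbk[x_{i,j}]$ and $S=\Bbbk[X_{i,j}]$, $1\le i,j\le n$, with $\deg X_{i,j}=1$. $S$ acts on $R$ by identifying $X_{i,j}$ with $x_{i,j}^{-1}$: for monomials $g\in S$, $f\in R$, $g\star f=gf$ if this lies in $R$, and $0$ otherwise, extended bilinearly. The apolar ideal of $f\in R$ is $f^\perp=\{g\in S: g\star f=0\}$; $\det_n,\operatorname{perm}_n\in R$ are the determinant and permanent of the matrix $(x_{i,j})$. For a graded $S$-module $M$ with minimal graded free resolution $\cdots\to F_2\to F_1\to F_0\to M\to 0$, the graded Betti numbers $\beta_{i,j}$ are defined by $F_i\cong\bigoplus_j S(-j)^{\beta_{i,j}}$. The dimension of the space of linear second syzygies of $M=S/\det_n^\perp$ or $M=S/\operatorname{perm}_n^\perp$ is the Betti number $\beta_{3,4}$ of $M$. Binomial coefficients $\binom{a}{b}$ with $0\le a<b$ are $0$.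
   Formalization: For the determinant, fields of characteristic 2 are allowed only for n ≤ 3: in characteristic 2 the determinant equals the permanent, so for n ≥ 4 the determinant formula is false there (it lacks the term 2·C(n,2)·C(n,4)). *)

(* Defs.v *)
From mathcomp Require Import all_boot all_order all_fingroup all_algebra.
From mathcomp Require Import mpoly.

Set Implicit Arguments.
Unset Strict Implicit.
Unset Printing Implicit Defensive.

Import GRing.Theory.
Local Open Scope ring_scope.

(* Both R = k[x_ij] and S = k[X_ij] are {mpoly k[n * n]}; the variable of     *)
(* index (i, j) is the one numbered by mxvec_index i j.                       *)
Definition generic_mx (k : fieldType) (n : nat) : 'M[{mpoly k[n * n]}]_n :=
  \matrix_(i, j) 'X_(mxvec_index i j).

Definition det_poly (k : fieldType) (n : nat) : {mpoly k[n * n]} :=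
  \det (generic_mx k n).

Definition perm_poly (k : fieldType) (n : nat) : {mpoly k[n * n]} :=
  \sum_(s : 'S_n) \prod_(i < n) generic_mx k n i (s i).

(* The bilinear extension of X^m * x^a = x^(a - m), to be read as 0 when      *)
(* x^(a - m) has a negative exponent.                                         *)
Definition contract (k : fieldType) (N : nat) (g f : {mpoly k[N]}) :
    {mpoly k[N]} :=
  \sum_(m <- msupp g) \sum_(a <- msupp f)
    (g@_m * f@_a) *: (if (m <= a)%MM then 'X_[(a - m)%MM] else 0).

Definition apolar (k : fieldType) (N : nat) (f : {mpoly k[N]}) :
    {pred {mpoly k[N]}} :=
  [pred g | contract g f == 0].

(* A sequence  ... -> F_2 -> F_1 -> F_0 -> S  of maps of finitely generated   *)
(* graded free modules over S = k[X_1, ..., X_N], in coordinates: F_i has a   *)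
(* basis indexed by 'I_(rk i) whose a-th element has degree shift i a, that   *)
(* is, F_i = \bigoplus_a S(- shift i a). Elements of F_i are row vectors, on  *)
(* which the maps act by right multiplication. Composing aug with the         *)
(* projection S -> S/I gives the augmentation F_0 -> S/I; conversely every    *)
(* map F_0 -> S/I lifts to S, as F_0 is free. Shifts are natural numbers      *)
(* because S/I has no elements of negative degree.                            *)
Record free_complex (k : fieldType) (N : nat) := FreeComplex {
  rk : nat -> nat;
  shift : forall i, 'I_(rk i) -> nat;
  aug : 'cV[{mpoly k[N]}]_(rk 0);
  diff : forall i, 'M[{mpoly k[N]}]_(rk i.+1, rk i) }.

(* The entries of a degree-preserving map S(-d) -> S(-e) have degree d - e;   *)
(* there is no nonzero such map when d < e.                                   *)
Definition degree_preserving (k : fieldType) (N : nat) (d e : nat)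
    (p : {mpoly k[N]}) : bool :=
  if (e <= d)%N then p \is (d - e).-homog else p == 0.

(* F is a minimal graded free resolution of S/I, for a homogeneous ideal I.   *)
(* Minimality is the condition that F_i.+1 is mapped into mF_i, where m is    *)
(* the ideal generated by the variables.                                      *)
Record minimal_graded_free_resolution (k : fieldType) (N : nat)
    (I : {pred {mpoly k[N]}}) (F : free_complex k N) : Prop :=
  MinimalGradedFreeResolution {
    aug_homog : forall a, aug F a 0 \is (shift a).-homog;
    diff_homog : forall i a b,
      degree_preserving (shift a) (shift b) (diff F i a b);
    aug_surj : forall g, exists u : 'rV_(rk F 0), g - (u *m aug F) 0 0 \in I;
    aug_exact : forall u : 'rV_(rk F 0),
      (u *m aug F) 0 0 \in I <-> exists v, u = v *m diff F 0;
    diff_exact : forall i (u : 'rV_(rk F i.+1)),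
      u *m diff F i = 0 <-> exists v, u = v *m diff F i.+1;
    diff_minimal : forall i a b, (diff F i a b)@_0%MM = 0 }.

(* The multiplicity of S(-j) in F_i. *)
Definition betti (k : fieldType) (N : nat) (F : free_complex k N)
    (i j : nat) : nat :=
  #|[set a : 'I_(rk F i) | shift a == j]|.

(* Main.v *)
Require Import Defs.
From mathcomp Require Import all_boot all_order all_fingroup all_algebra.
From mathcomp Require Import mpoly.
From mathcomp Require Import zify ring.

(** The Betti number [betti F 3 4] only sees the linear strand of the resolution.
    Let [I] be the apolar ideal and [N = n * n]. A basis element of degree 4 of
    [F_3] is sent to a combination of basis elements of degree 3 of [F_2] with
    linear coefficients, each of these to a combination of basis elements of
    degree 2 of [F_1] with linear coefficients, and each of the latter to a quadric
    of [I]. Splitting the two linear steps along the variables turns a vector [v]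
    of degree 4 into an [N * N] array of quadrics [P a b] of [I]. Exactness and
    minimality make [v |-> P] a linear bijection onto the arrays that are
    alternating and satisfy [\sum_b 'X_b * P a b = 0] for all [a]
    ([strand_syzygyP], [strand_syzygy_inj], [strand_syzygy_surj]); so
    [betti F 3 4] is the dimension of the space of these arrays.

    The determinant and the permanent are [\sum_s e ^+ s *: X^s] for [e = -1] and
    [e = 1]. Contracting a quadric with this polynomial pairs the two monomials
    [x_ij x_i'j'] and [x_ij' x_i'j] that can complete the same monomial to a
    permutation; so a quadric is in [I] iff its coefficients at these two monomials
    add up to zero when the second one is multiplied by [e] ([apolar_quadric]). In
    degree 0 and 1 there is nothing to pair, and [I] is zero ([apolar_ldegree]).

    The coefficients [q ((a, b), (c, c'))] of [P a b] at [X_c X_c'] are therefore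
    the solutions of explicit linear equations with coefficients 1, -1 and [e]
    ([syzygy_eqns]). Each equation relates entries that involve the same rows and
    the same columns, with the same multiplicities, four of each, and its shape
    depends only on the equalities among them. So the system splits into pieces
    indexed by a set [A] of at most four rows and a set [B] of at most four columns,
    and the piece depends on [#|A|] and [#|B|] only: the dimension is
    [\sum_(l, m) 'C(n, l) * 'C(n, m) * D l m], where [D l m] is the number of free
    coordinates when exactly [l] rows and [m] columns occur ([card_free_quads]).

    The sixteen numbers [D l m] are found by integer elimination. As all pivots are
    1 or -1, possibly after dividing an equation by 2, the answer holds over every
    field in which the divisions made are allowed ([solve_sound]). For the
    permanent no division occurs. For the determinant divisions occur only when four
    rows or four columns are involved, whence the restriction to [n <= 3] in
    characteristic 2, where the determinant is the permanent. *)

Set Implicit Arguments.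
Unset Strict Implicit.
Unset Printing Implicit Defensive.

Import GRing.Theory.
Local Open Scope ring_scope.

(** * Elimination for integer linear equations *)

(** A row [r] stands for the equation [\sum_(ct <- r) ct.1 * x_(ct.2) = 0]. *)
Definition equation (L : eqType) := seq (int * L).

Section Elimination.
Variable L : eqType.
Implicit Types (x y : L) (r t : equation L).

Fixpoint add_term (c : int) x r : equation L :=
  if r is (c', y) :: r' then
    if x == y then
      let s := c + c' in if s == 0 then r' else (s, y) :: r'
    else (c', y) :: add_term c x r'
  else [:: (c, x)].

Fixpoint add_scaled (e : int) t r : equation L :=
  if t is (c, x) :: t' then add_scaled e t' (add_term (e * c) x r) else r.

Fixpoint extract x r : int * equation L :=
  if r is (c, y) :: r' then
    let: (c', t) := extract x r' in
    if x == y then (c + c', t) else (c', (c, y) :: t)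
  else (0, [::]).

(** Subtracts the multiple of the pivot equation [u * x + t = 0] that kills [x]
    in [r]; as [u] is 1 or -1, the multiplier needs no division. *)
Definition eliminate (u : int) x t r : equation L :=
  let: (c, r') := extract x r in
  if c == 0 then r' else add_scaled (- (c * u)) t r'.

Definition halve (c : int) : int :=
  match c with Posz m => Posz m./2 | Negz m => Negz m./2 end.

Definition even_row r := all (fun ct => ~~ odd `|ct.1|) r.

Definition half_row r : equation L := [seq (halve ct.1, ct.2) | ct <- r].

Definition unit_coef (c : int) := (c == 1) || (c == -1).

Fixpoint unit_term r : option L :=
  if r is (c, x) :: r' then if unit_coef c then Some x else unit_term r'
  else None.

(** Elimination of the system [E] in the unknowns [vs], with [n] as fuel. In a
    result [Some (h, fs)], the unknowns [fs] have not been used as pivots, and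
    [h] tells whether an equation has been divided by 2, which is done as soon
    as its coefficients are even. The result is [None] if an equation has no
    coefficient 1 or -1 to pivot on. *)
Fixpoint solve n (vs : seq L) (E : seq (equation L)) : option (bool * seq L) :=
  match E, n with
  | [::], _ => Some (false, vs)
  | _, 0 => None
  | [::] :: E', n'.+1 => solve n' vs E'
  | r :: E', n'.+1 =>
    let h := even_row r in
    let r1 := if h then half_row r else r in
    if unit_term r1 is Some x then
      let: (u, t) := extract x r1 in
      let E1 := [seq eliminate u x t r2 | r2 <- E'] in
      if unit_coef u then
        if solve n' (rem x vs) [seq r2 <- E1 | ~~ nilp r2] is Some (h', fs)
        then Some (h || h', fs) else None
      else None
    else None
  end.

End Elimination.

Section EliminationSound.
Variables (k : fieldType) (L : eqType).
Implicit Types (q g : L -> k) (x y : L) (r t : equation L).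

Definition value (A : Type) (f : A -> k) (r : seq (int * A)) : k :=
  \sum_(ct <- r) ct.1%:~R * f ct.2.

Definition solution (E : seq (equation L)) q :=
  forall r, r \in E -> value q r = 0.

Lemma value_nil q : value q [::] = 0.
Proof. by rewrite /value big_nil. Qed.

Lemma value_cons q c x r : value q ((c, x) :: r) = c%:~R * q x + value q r.
Proof. by rewrite /value big_cons. Qed.

Lemma value_add_term q c x r :
  value q (add_term c x r) = c%:~R * q x + value q r.
Proof.
elim: r => [|[c' y] r IHr] /=; first by rewrite value_cons.
case: eqP => [<-|_]; last by rewrite !value_cons IHr addrCA.
have sumE : (c + c')%:~R * q x + value q r =
    c%:~R * q x + (c'%:~R * q x + value q r) by rewrite intrD mulrDl addrA.
case: eqP => [s0|_]; rewrite !value_cons -sumE //.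
by rewrite s0 mul0r add0r.
Qed.

Lemma value_add_scaled q e t r :
  value q (add_scaled e t r) = e%:~R * value q t + value q r.
Proof.
elim: t r => [|[c x] t IHt] r /=; first by rewrite value_nil mulr0 add0r.
by rewrite IHt value_add_term value_cons mulrDr intrM mulrA addrCA addrA.
Qed.

Lemma value_extract q x r :
  value q r = (extract x r).1%:~R * q x + value q (extract x r).2.
Proof.
elim: r => [|[c y] r IHr] /=; first by rewrite value_nil mul0r add0r.
rewrite value_cons IHr; case: (extract x r) => c' t /=.
case: eqP => [<-|_] /=; first by rewrite intrD mulrDl addrA.
by rewrite value_cons addrCA.
Qed.

Definition occurs x r := has (fun ct => ct.2 == x) r.

Lemma eq_value q q' r :
  (forall x, occurs x r -> q x = q' x) -> value q r = value q' r.
Proof.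
move=> qq'; apply: eq_big_seq => ct ct_r; congr (_ * _); apply: qq'.
by apply/hasP; exists ct.
Qed.

Lemma occurs_add_term x c y r :
  occurs x (add_term c y r) -> (y == x) || occurs x r.
Proof.
elim: r => [|[c' z] r IHr] //=.
case: eqP => [<-|_] /=.
  by case: eqP => _ /=; [move=> ->; rewrite !orbT | case/orP=> ->; rewrite ?orbT].
by case/orP=> [-> | /IHr /orP[] ->]; rewrite ?orbT.
Qed.

Lemma occurs_add_scaled x e t r :
  occurs x (add_scaled e t r) -> occurs x t || occurs x r.
Proof.
elim: t r => [|[c y] t IHt] r //= /IHt /orP[->|/occurs_add_term /orP[] ->];
  by rewrite ?orbT.
Qed.

Lemma occurs_extract x r : ~~ occurs x (extract x r).2.
Proof.
elim: r => [|[c y] r IHr] //=; case: (extract x r) IHr => c' t /= IHr.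
by case: eqP => //= /eqP; rewrite eq_sym => /negPf ->.
Qed.

Lemma occurs_eliminate u x y t r :
  occurs y (eliminate u x t r) -> occurs y t || occurs y (extract x r).2.
Proof.
rewrite /eliminate; case: (extract x r) => c r' /=.
by case: eqP => _; [move=> ->; rewrite orbT | move/occurs_add_scaled].
Qed.

Lemma value_eliminate q u x t r :
  unit_coef u ->
  value q (eliminate u x t r) =
    value q r - ((extract x r).1 * u)%:~R * (u%:~R * q x + value q t).
Proof.
move=> unit_u; rewrite /eliminate (value_extract q x r).
case: (extract x r) => c r' /=; case: eqP => [->|_].
  by rewrite [0 * u]mul0r !mulr0z !mul0r add0r subr0.
rewrite value_add_scaled mulrDr opprD addrACA rmorphN mulNr.
suff ->: (c * u)%:~R * (u%:~R * q x) = c%:~R * q x by rewrite subrr add0r addrC.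
rewrite mulrA -intrM -mulrA.
by case/orP: unit_u => /eqP->; rewrite ?mulr1 // mulrNN mulr1.
Qed.

Lemma value_half_row q r :
  (2 : k) != 0 -> even_row r -> (value q (half_row r) == 0) = (value q r == 0).
Proof.
move=> two_neq0 even_r.
suff ->: value q r = 2 * value q (half_row r).
  by rewrite mulf_eq0 (negPf two_neq0).
rewrite /value big_map mulr_sumr; apply: eq_big_seq => -[c x] /= cx_r.
have c2 : c = 2 * halve c.
  have := allP even_r _ cx_r; case: c {cx_r} => m /= even_m.
    by rewrite -PoszM mul2n even_halfK.
  rewrite !NegzE mulrN -PoszM; congr (- Posz _); rewrite mul2n.
  move: even_m; rewrite negbK /= => odd_m.
  by rewrite doubleS -{1}(odd_double_half m) odd_m.
by rewrite {1}c2 mulrA intrM.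
Qed.

Lemma solution_filter E q :
  solution [seq r <- E | ~~ nilp r] q <-> solution E q.
Proof.
split=> sol r; last by rewrite mem_filter => /andP[_ /sol].
case: (boolP (nilp r)) => [/nilP-> _ | r_n0 r_E]; first exact: value_nil.
by apply: sol; rewrite mem_filter r_n0.
Qed.

(** Every pivot stays invertible in every field, and halving an equation is
    harmless where 2 is invertible; so the unknowns left over parametrise the
    solutions over [k]. They determine a solution because each pivot equation
    expresses its pivot in terms of the later unknowns; they can be prescribed
    because a solution of the equations freed from a pivot extends to that
    pivot. *)
Theorem solve_sound n vs E h fs :
    solve n vs E = Some (h, fs) -> uniq vs -> (h -> (2 : k) != 0) ->
  [/\ {subset fs <= vs},
      forall q, solution E q -> (forall x, x \notin vs -> q x = 0) ->
        {in fs, forall x, q x = 0} -> forall x, q x = 0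
    & forall g, exists2 q, solution E q & {in fs, q =1 g}].
Proof.
elim: n vs E h fs => [|n IHn] vs [|r E] h fs /=; do ?by [].
- move=> [_ <-] _ _; split=> // [q _ q_out q_in x|g]; last by exists g.
  by case: (boolP (x \in vs)) => [/q_in|/q_out].
- by case: r.
- move=> [_ <-] _ _; split=> // [q _ q_out q_in x|g]; last by exists g.
  by case: (boolP (x \in vs)) => [/q_in|/q_out].
set h0 := even_row r; set r1 := (if h0 then _ else _).
case: r @h0 @r1 => [|ct r0] h0 r1.
  move=> sol uniq_vs two; have [sub_fs uniq_q ex_q] := IHn _ _ _ _ sol uniq_vs two.
  split=> // [q solE|g]; first by apply: uniq_q => r r_E; rewrite solE // inE r_E orbT.
  have [q solE q_g] := ex_q g; exists q => // r; rewrite inE.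
  by case/predU1P=> [->|/solE//]; rewrite value_nil.
set r := ct :: r0 in h0 r1 *.
case: unit_term => // x; case def_t: (extract x r1) => [u t].
case: ifP => // unit_u; case sol: solve => [[h' fs']|//] [<- <-] uniq_vs two.
have two' : h' -> (2 : k) != 0 by move=> h'1; rewrite two // h'1 orbT.
have [sub_fs uniq_q ex_q] := IHn _ _ _ _ sol (rem_uniq x uniq_vs) two'.
have r1P q : (value q r == 0) = (u%:~R * q x + value q t == 0).
  have <-: value q r1 = u%:~R * q x + value q t.
    by rewrite (value_extract q x) def_t.
  rewrite /r1; case h0E: h0 => //; rewrite -value_half_row //.
  by rewrite two // h0E.
have t_x : ~~ occurs x t by have := occurs_extract x r1; rewrite def_t.
have u_neq0 : u%:~R != 0 :> k.
  by case/orP: unit_u => /eqP->; rewrite ?rmorphN ?oppr_eq0 oner_eq0.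
pose E1 := [seq eliminate u x t r2 | r2 <- E].
have E1_x r2 : r2 \in E1 -> ~~ occurs x r2.
  case/mapP=> r3 _ ->; apply/negP => /occurs_eliminate.
  by rewrite (negPf t_x) (negPf (occurs_extract x r3)).
(* The value at the pivot does not matter for the equations freed from it. *)
have solE1 q q' : (forall y, y != x -> q y = q' y) -> solution E1 q -> solution E1 q'.
  move=> qq' solq r2 r2_E1; rewrite -(solq r2 r2_E1); apply: eq_value => y y_r2.
  by rewrite qq' //; apply: contraNneq (E1_x _ r2_E1) => <-.
have r_E1 q : value q r = 0 -> solution E q <-> solution E1 q.
  move=> /eqP; rewrite r1P => /eqP q_r; split=> solq r2.
    by case/mapP=> r3 /solq r3_0 ->; rewrite value_eliminate // q_r mulr0 subr0.
  move=> r2_E; have := solq _ (map_f _ r2_E).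
  by rewrite value_eliminate // q_r mulr0 subr0.
split=> [y /sub_fs /mem_rem // | q solq q_out q_fs | g].
  have [q_r solEq] : value q r = 0 /\ solution E q.
    by split=> [|r2 r2_E]; apply: solq; rewrite inE ?eqxx // r2_E orbT.
  pose q1 y := if y == x then 0 else q y.
  have q1_0 : forall y, q1 y = 0.
    apply: uniq_q => [|y|y y_fs]; rewrite /q1; first 1 last.
    - by case: eqP => // /eqP y_x; rewrite mem_rem_uniq // !inE y_x => /q_out.
    - by case: eqP => // _; apply: q_fs.
    apply/solution_filter; apply: solE1 (iffLR (r_E1 q q_r) solEq) => y.
    by move/negPf=> ->.
  have q_x y : y != x -> q y = 0 by move=> y_x; have := q1_0 y; rewrite /q1 (negPf y_x).
  move=> y; case: (eqVneq y x) => [->|/q_x //]; apply/eqP.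
  have t_0 : value q t = 0.
    rewrite (@eq_value q (fun=> 0)) => [|z z_t]; last first.
      by apply: q_x; apply: contraNneq t_x => <-.
    by rewrite /value big1 // => ct' _; rewrite mulr0.
  by move/eqP: q_r; rewrite r1P t_0 addr0 mulf_eq0 (negPf u_neq0).
have [q /solution_filter solq q_g] := ex_q g.
pose q1 y := if y == x then - (u%:~R^-1 * value q t) else q y.
have q1_q y : y != x -> q1 y = q y by rewrite /q1 => /negPf->.
have q1_r : value q1 r = 0.
  apply/eqP; rewrite r1P {1}/q1 eqxx mulrN mulVKf //.
  rewrite (@eq_value q1 q) ?addNr // => y y_t.
  by apply: q1_q; apply: contraNneq t_x => <-.
exists q1 => [r2|y y_fs].
  rewrite inE => /predU1P[-> //|]; apply: (iffRL (r_E1 q1 q1_r)).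
  by apply: solE1 solq => z /q1_q.
rewrite q1_q ?q_g //; apply: contraTneq y_fs => ->.
by apply/negP => /sub_fs; rewrite mem_rem_uniqF.
Qed.
End EliminationSound.

(** * The equations on the coefficients of a syzygy *)

(** The index [((a, b), (c, e))] stands for the coefficient at [X_c X_e] of the
    entry [(a, b)] of a square array of quadrics; [a], [b], [c], [e] are cells,
    given by a row in [I] and a column in [J]. *)
Definition quad (I J : Type) : Type :=
  ((I * J) * (I * J)) * ((I * J) * (I * J)).

Definition rows I J (x : quad I J) : seq I :=
  let: ((a, b), (c, e)) := x in [:: a.1; b.1; c.1; e.1].

Definition cols I J (x : quad I J) : seq J :=
  let: ((a, b), (c, e)) := x in [:: a.2; b.2; c.2; e.2].

Definition relabel I J I' J' (f : I -> I') (g : J -> J') (x : quad I J) :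
    quad I' J' :=
  let: ((a, b), (c, e)) := x in
  let h u := (f u.1, g u.2) in ((h a, h b), (h c, h e)).

Lemma rows_relabel I J I' J' (f : I -> I') (g : J -> J') x :
  rows (relabel f g x) = map f (rows x).
Proof. by case: x => -[a b] [c e]. Qed.

Lemma cols_relabel I J I' J' (f : I -> I') (g : J -> J') x :
  cols (relabel f g x) = map g (cols x).
Proof. by case: x => -[a b] [c e]. Qed.

Section SyzygyEquations.
Variables (I J : eqType) (d : int).

(** The equations based at [((a, b), (c, e))] express, in this order, that the
    array is alternating, that the coefficients are symmetric in the two
    variables, that [\sum_z X_z * P a z] has no term in [X_b X_c X_e], and that
    [P a b] is apolar to the determinant ([d = -1]) or to the permanent ([d =
    1]). When cells coincide, equal terms are listed once: so the first equation
    says that the diagonal vanishes even in characteristic 2, and the third one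
    treats monomials with repeated variables. *)
Definition syzygy_eqns (x : quad I J) : seq (equation (quad I J)) :=
  let: ((a, b), (c, e)) := x in
  [:: (1, x) :: (if a == b then [::] else [:: (1, ((b, a), (c, e)))]);
      [:: (1, x); (-1, ((a, b), (e, c)))];
      (1, x) :: (if c == b then [::] else [:: (1, ((a, c), (b, e)))]) ++
        (if (e == b) || (e == c) then [::] else [:: (1, ((a, e), (b, c)))]);
      (if (c.1 == e.1) || (c.2 == e.2) then [::]
       else [:: (1, x); (d, ((a, b), ((c.1, e.2), (e.1, c.2))))])].

(** No equation relates entries with different multisets of rows or of columns:
    the system splits along these multisets. *)
Lemma syzygy_eqns_content x r ct :
    r \in syzygy_eqns x -> ct \in r ->
  perm_eq (rows ct.2) (rows x) /\ perm_eq (cols ct.2) (cols x).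
Proof.
case: x => -[a b] [c e] r_x ct_r.
have: ct.2 \in [:: ((a, b), (c, e)); ((b, a), (c, e)); ((a, b), (e, c));
  ((a, c), (b, e)); ((a, e), (b, c)); ((a, b), ((c.1, e.2), (e.1, c.2)))].
  move: r_x ct_r; rewrite !inE => /or4P[] /eqP->; do ?case: ifP => _;
    rewrite ?(in_cons, mem_cat, in_nil) ?orbF -?orbA //; do ?[case/orP];
    by move=> /eqP-> /=; rewrite eqxx ?orbT.
rewrite !inE => /or4P[|||/or3P[]] /eqP-> /=;
  by split; apply/seq.permP => p /=; ring.
Qed.

End SyzygyEquations.

(** The shape of an equation depends only on which cells, rows and columns are
    equal. *)
Lemma syzygy_eqns_relabel (I J I' J' : eqType) d (f : I -> I') (g : J -> J') x :
    injective f -> injective g ->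
  syzygy_eqns d (relabel f g x) =
    [seq [seq (ct.1, relabel f g ct.2) | ct <- r] | r <- syzygy_eqns d x].
Proof.
move=> inj_f inj_g; case: x => -[a b] [c e] /=.
have eq_h u v : ((f u.1, g u.2) == (f v.1, g v.2)) = (u == v).
  by case: u v => [i j] [i' j'] /=; rewrite !xpair_eqE (inj_eq inj_f) (inj_eq inj_g).
rewrite !eq_h (inj_eq inj_f) (inj_eq inj_g).
by do 4?case: ifP => _ /=.
Qed.

Lemma value_relabel (k : fieldType) (A B : Type) (h : A -> B) (q : B -> k) r :
  value q [seq (ct.1, h ct.2) | ct <- r] = value (q \o h) r.
Proof. by rewrite /value big_map. Qed.

(** The unknowns [fs] parametrise the solutions on [A] of the equations based at
    [A]. *)
Definition free_coordinates (k : fieldType) (I J : eqType) (d : int)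
    (A : quad I J -> Prop) (fs : seq (quad I J)) : Prop :=
  let solves (q : quad I J -> k) :=
    forall x, A x -> solution (syzygy_eqns d x) q in
  [/\ {in fs, forall x, A x},
      forall q, solves q -> {in fs, forall x, q x = 0} ->
        forall x, A x -> q x = 0
    & forall g, exists2 q, solves q & {in fs, q =1 g}].

(** * Solving the equations one content at a time *)

Definition lex_lt (u v : nat * nat) :=
  (u.1 < v.1)%N || ((u.1 == v.1) && (u.2 < v.2)%N).

(** The first two equations identify up to sign the unknowns that differ by
    exchanging the two entries of a pair. Elimination is run on one
    representative of each class, which shortens it considerably; [fold_quad x]
    is the representative of [x]. *)
Definition fold_sign (x : quad nat nat) : int :=
  if lex_lt x.1.2 x.1.1 then -1 else 1.

Definition fold_quad (x : quad nat nat) : quad nat nat :=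
  let: ((a, b), (c, e)) := x in
  ((if lex_lt b a then (b, a) else (a, b)),
   (if lex_lt e c then (e, c) else (c, e))).

Definition folded (x : quad nat nat) :=
  lex_lt x.1.1 x.1.2 && ~~ lex_lt x.2.2 x.2.1.

Fixpoint fold_row (r : equation (quad nat nat)) : equation (quad nat nat) :=
  if r is (c, x) :: r' then
    add_term (c * fold_sign x) (fold_quad x) (fold_row r')
  else [::].

Definition quad_of_words (r c : seq nat) : quad nat nat :=
  let cell i := (nth 0 r i, nth 0 c i)%N in
  ((cell 0, cell 1), (cell 2, cell 3))%N.

Definition block (al be : seq nat) :=
  [seq quad_of_words r c | r <- permutations al, c <- permutations be].

Definition solve_block d al be :=
  let ws := block al be in
  let E := [seq fold_row r | r <- flatten [seq syzygy_eqns d x | x <- ws]] in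
  let E1 := [seq r <- E | ~~ nilp r] in
  solve (size E1) [seq x <- ws | folded x] E1.

Section BlockSound.
Variables (k : fieldType) (d : int).
Implicit Types (q g : quad nat nat -> k) (x : quad nat nat).

Definition unfolded q x : k := (fold_sign x)%:~R * q (fold_quad x).

Lemma value_fold_row q r : value q (fold_row r) = value (unfolded q) r.
Proof.
elim: r => [|[c x] r IHr] /=; first by rewrite !value_nil.
by rewrite value_add_term value_cons IHr intrM mulrA.
Qed.

Lemma lex_lt_irr u : lex_lt u u = false.
Proof. by rewrite /lex_lt !ltnn andbF. Qed.

Lemma lex_lt_asym u v : lex_lt u v -> lex_lt v u = false.
Proof. by rewrite /lex_lt; lia. Qed.

Lemma lex_lt_total u v : ~~ lex_lt u v -> ~~ lex_lt v u -> u = v.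
Proof. by case: u v => [a b] [c e]; rewrite /lex_lt /= => *; congr (_, _); lia. Qed.

Lemma unfolded_folded q x : folded x -> unfolded q x = q x.
Proof.
case: x => -[a b] [c e]; rewrite /folded /unfolded /fold_sign /=.
by case/andP=> /lex_lt_asym-> /negPf->; rewrite mul1r.
Qed.

(** A representative that is not [folded] has two equal cells in its first pair,
    so its unknown vanishes. *)
Lemma fold_quadP x :
  folded (fold_quad x) || ((fold_quad x).1.1 == (fold_quad x).1.2).
Proof.
case: x => -[a b] [c e]; rewrite /folded /=.
have ->: ~~ lex_lt (if lex_lt e c then (e, c) else (c, e)).2
                   (if lex_lt e c then (e, c) else (c, e)).1.
  by case e_c: (lex_lt e c); rewrite /= ?e_c ?(lex_lt_asym e_c).
have [b_a|b_a] := boolP (lex_lt b a); first by rewrite b_a.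
have [a_b|a_b] //= := boolP (lex_lt a b).
by rewrite (lex_lt_total a_b b_a) eqxx.
Qed.

Variables (al be : seq nat).
Hypotheses (size_al : size al = 4%N) (size_be : size be = 4%N).

Lemma mem_block x :
  (x \in block al be) = perm_eq (rows x) al && perm_eq (cols x) be.
Proof.
apply/allpairsP/andP => [[[r c]]|[r_al c_be]]; last first.
  exists (rows x, cols x); rewrite !mem_permutations; split=> //.
  by case: x {r_al c_be} => -[[? ?] [? ?]] [[? ?] [? ?]].
rewrite !mem_permutations /= => -[r_al c_be ->].
have := perm_size r_al; have := perm_size c_be; rewrite size_al size_be.
case: r r_al => [|r0 [|r1 [|r2 [|r3 []]]]] //.
by case: c c_be => [|c0 [|c1 [|c2 [|c3 []]]]].
Qed.

Lemma block_uniq : uniq (block al be).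
Proof.
apply: allpairs_uniq; rewrite ?permutations_uniq // => -[r c] [r' c'].
case/allpairsP=> -[r1 c1] /=; rewrite !mem_permutations => -[r_al c_be [-> ->]].
case/allpairsP=> -[r2 c2] /=; rewrite !mem_permutations => -[r'_al c'_be [-> ->]].
have := perm_size r_al; have := perm_size c_be; rewrite size_al size_be.
have := perm_size r'_al; have := perm_size c'_be; rewrite size_al size_be.
case: r1 {r_al} => [|? [|? [|? [|? []]]]] //.
case: c1 {c_be} => [|? [|? [|? [|? []]]]] //.
case: r2 {r'_al} => [|? [|? [|? [|? []]]]] //.
case: c2 {c'_be} => [|? [|? [|? [|? []]]]] //.
by move=> _ _ _ _ [-> -> -> -> -> -> -> ->].
Qed.

Definition solves_block q :=
  {in block al be, forall x, solution (syzygy_eqns d x) q}.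

Lemma block_closed x r ct :
    x \in block al be -> r \in syzygy_eqns d x -> ct \in r ->
  ct.2 \in block al be.
Proof.
rewrite !mem_block => /andP[x_al x_be] r_x ct_r.
have [rows_ct cols_ct] := syzygy_eqns_content r_x ct_r.
by rewrite (perm_trans rows_ct) ?(perm_trans cols_ct).
Qed.

Lemma solves_block_unfolded q x :
  solves_block q -> x \in block al be -> q x = unfolded q x.
Proof.
move=> sol_q x_blk.
have first_pair y : y \in block al be -> lex_lt y.1.2 y.1.1 ->
    q y = - q ((y.1.2, y.1.1), y.2).
  case: y => -[a b] [c e] y_blk /= b_a; apply/eqP; rewrite -addr_eq0.
  have := sol_q _ y_blk _ (mem_head _ _); rewrite ifF ?value_cons ?value_nil.
    by rewrite !mul1r addr0 => ->.
  by apply: contraTF b_a => /eqP->; rewrite lex_lt_irr.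
have second_pair y : y \in block al be -> q y = q (y.1, (y.2.2, y.2.1)).
  case: y => -[a b] [c e] y_blk /=; apply/eqP; rewrite -subr_eq0.
  have := sol_q _ y_blk [:: (1, ((a, b), (c, e))); (-1, ((a, b), (e, c)))].
  rewrite !inE eqxx orbT !value_cons value_nil mul1r addr0 mulN1r => -> //.
case: x x_blk => -[a b] [c e] x_blk; rewrite /unfolded /fold_sign /=.
have second_fold y :
    ((y, (c, e)) : quad nat nat) \in block al be ->
    q (y, (c, e)) = q (y, if lex_lt e c then (e, c) else (c, e)).
  by move=> y_blk; case: ifP => // _; apply: second_pair.
case: ifP => b_a; last by rewrite mul1r; apply: second_fold.
rewrite mulN1r first_pair //= second_fold //.
move: x_blk; rewrite !mem_block => /andP[/= x_al x_be].
by apply/andP; split; [apply: perm_trans x_al | apply: perm_trans x_be];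
  apply/seq.permP => p /=; ring.
Qed.

(** A solution of the folded system extends to all the unknowns by [unfolded];
    conversely a solution of the full system is the unfolding of its restriction
    to representatives. *)
Theorem solve_block_sound h fs :
    solve_block d al be = Some (h, fs) -> (h -> (2 : k) != 0) ->
  free_coordinates k d (fun x => x \in block al be) fs.
Proof.
rewrite /solve_block; set ws := block al be.
set E := map _ _; set vs := filter _ ws => run two.
have [sub_fs uniq_q ex_q] := solve_sound run (filter_uniq _ block_uniq) two.
have EP q : solution E q <-> solves_block (unfolded q).
  split=> [sol x x_ws r r_x|sol r].
    rewrite -value_fold_row; apply/sol/map_f/flatten_mapP.
    by exists x.
  by case/mapP=> r' /flatten_mapP[x x_ws r'_x] ->; rewrite value_fold_row (sol x).
split=> [x /sub_fs|q sol_q q_fs|g].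
- by rewrite mem_filter => /andP[].
- pose q1 x := if x \in vs then q x else 0.
  have q_unf x : x \in ws -> q x = unfolded q1 x.
    move=> x_ws; rewrite (solves_block_unfolded sol_q x_ws) /unfolded /q1.
    case: ifP => // /negP not_vs; congr (_ * _).
    have fx_ws : fold_quad x \in ws.
      move: x_ws; rewrite !mem_block; case: (x) => -[a b] [c e] /=.
      case/andP=> x_al x_be; apply/andP; split;
        [apply: perm_trans x_al | apply: perm_trans x_be];
        by do 2!case: ifP => _; apply/seq.permP => p /=; ring.
    case/orP: (fold_quadP x) => [fx|].
      by case: not_vs; rewrite mem_filter fx.
    case: (fold_quad x) fx_ws => -[a b] [c e] x_blk /= /eqP ab.
    have := sol_q _ x_blk _ (mem_head _ _).
    by rewrite ab eqxx value_cons value_nil mul1r addr0.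
  have q1_0 : forall x, q1 x = 0.
    apply: uniq_q => [|x|x x_fs].
    - apply/solution_filter/EP => x x_ws r r_x; rewrite -(sol_q x x_ws r r_x).
      apply: eq_value => y /hasP[ct ct_r /eqP <-].
      by rewrite -q_unf // (block_closed x_ws r_x ct_r).
    - by rewrite /q1 => /negPf->.
    - by rewrite /q1 q_fs // if_same.
  by move=> x x_ws; rewrite q_unf // /unfolded q1_0 mulr0.
- have [q /solution_filter/EP sol_q q_g] := ex_q g.
  exists (unfolded q) => // x x_fs; rewrite unfolded_folded ?q_g //.
  by have := sub_fs _ x_fs; rewrite mem_filter => /andP[].
Qed.
End BlockSound.

Fixpoint words (s l : nat) : seq (seq nat) :=
  if s is s'.+1 then [seq i :: w | i <- iota 0 l, w <- words s' l]
  else [:: [::]].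

(** A content is a multiset of four labels, represented by its sorted word. *)
Definition contents l :=
  [seq w <- words 4 l | sorted leq w & all (fun i => i \in w) (iota 0 l)].

Lemma mem_words s l w :
  (w \in words s l) = (size w == s) && all (fun i => i < l)%N w.
Proof.
elim: s w => [|s IHs] w /=; first by rewrite inE; case: w.
apply/allpairsP/idP => [[[i w'] /= [i_l w'_s ->]]|]; last first.
  case: w => //= i w /andP[/eqP[size_w] /andP[i_l w_l]].
  by exists (i, w); rewrite /= mem_iota IHs size_w eqxx.
by move: w'_s i_l; rewrite IHs mem_iota /= eqSS => /andP[-> ->] ->.
Qed.

Lemma contentsP l w :
  reflect [/\ size w = 4%N, sorted leq w & w =i iota 0 l] (w \in contents l).
Proof.
rewrite mem_filter mem_words; apply: (iffP and3P) => [[/andP[w_sorted w_l] size_w]|].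
  move=> w_lt; split=> //; first exact/eqP.
  move=> i; apply/idP/idP; last by move/(allP w_l).
  by rewrite mem_iota; apply: (allP w_lt).
case=> size_w w_sorted w_l; rewrite w_sorted size_w; split=> //.
  by apply/allP => i; rewrite w_l.
by apply/allP => i; rewrite w_l mem_iota.
Qed.

Lemma sort_contents l w :
  size w = 4%N -> w =i iota 0 l -> sort leq w \in contents l.
Proof.
move=> size_w w_l; apply/contentsP; split; first by rewrite size_sort.
  exact/sort_sorted/leq_total.
by move=> i; rewrite mem_sort.
Qed.

Lemma seq_choice (K : eqType) (T : Type) (t0 : T) (s : seq K) (P : K -> T -> Prop) :
  {in s, forall x, exists y, P x y} -> exists f, {in s, forall x, P x (f x)}.
Proof.
elim: s => [|x s IHs] exP; first by exists (fun=> t0).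
have [|f fP] := IHs; first by move=> y y_s; apply: exP; rewrite inE y_s orbT.
have [y xy] := exP x (mem_head x s).
exists (fun z => if z == x then y else f z) => z; rewrite inE.
by case: eqP => [-> //|_] /= /fP.
Qed.

Definition keys l m := [seq (al, be) | al <- contents l, be <- contents m].

Definition results d l m := [seq solve_block d ab.1 ab.2 | ab <- keys l m].

(** The flag [two] tells whether dividing by 2 is allowed. *)
Definition solved (two : bool) (res : option (bool * seq (quad nat nat))) :=
  if res is Some (h, _) then h ==> two else false.

Definition frees (res : option (bool * seq (quad nat nat))) :=
  if res is Some (_, fs) then fs else [::].

Definition onto l m (x : quad nat nat) :=
  rows x =i iota 0 l /\ cols x =i iota 0 m.

(** Blocks with different contents share no unknown and no equation, so free
    coordinates of the blocks together form free coordinates of their union. *)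
Theorem results_sound (k : fieldType) d l m two :
    all (solved two) (results d l m) -> (two -> (2 : k) != 0) ->
  free_coordinates k d (onto l m) (flatten (map frees (results d l m))).
Proof.
set fs := flatten _ => all_solved two_neq0.
have keysP ab : ab \in keys l m ->
    [/\ ab.1 \in contents l, ab.2 \in contents m, size ab.1 = 4%N & size ab.2 = 4%N].
  by case/allpairsP=> -[al be] /= [al_l be_m ->];
     have [? _ _] := contentsP _ _ al_l; have [? _ _] := contentsP _ _ be_m.
pose key (x : quad nat nat) := (sort leq (rows x), sort leq (cols x)).
have block_key ab x :
    ab \in keys l m -> x \in block ab.1 ab.2 -> key x = ab /\ onto l m x.
  move=> /keysP[al_l be_m size_al size_be].
  rewrite mem_block // => /andP[x_al x_be].
  have [_ al_sorted al_eq] := contentsP _ _ al_l.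
  have [_ be_sorted be_eq] := contentsP _ _ be_m.
  split; last by split=> i; rewrite ?(perm_mem x_al) ?(perm_mem x_be).
  rewrite [ab]surjective_pairing /key.
  congr (_, _); apply: (sorted_eq leq_trans anti_leq) => //;
    by rewrite ?sort_sorted ?perm_sort //; apply: leq_total.
have key_block x :
    onto l m x -> key x \in keys l m /\ x \in block (key x).1 (key x).2.
  case=> x_l x_m; have size_rows : size (rows x) = 4%N by case: (x) => -[? ?] [].
  have size_cols : size (cols x) = 4%N by case: (x) => -[? ?] [].
  rewrite mem_block ?size_sort // 2!(perm_sym _ (sort _ _)) !perm_sort !perm_refl.
  by split=> //; apply/allpairsP; exists (key x); rewrite !sort_contents.
pose F ab := frees (solve_block d ab.1 ab.2).
have F_free ab : ab \in keys l m ->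
    free_coordinates k d (fun x => x \in block ab.1 ab.2) (F ab).
  move=> ab_ks; have [_ _ size_al size_be] := keysP _ ab_ks.
  have := allP all_solved _ (map_f _ ab_ks); rewrite /F /solved.
  case run: solve_block => [[h fs']|//] /= /implyP h_two.
  by apply: (solve_block_sound size_al size_be run) => /h_two.
have mem_fs x : reflect (exists2 ab, ab \in keys l m & x \in F ab) (x \in fs).
  by rewrite /fs -map_comp; apply: flatten_mapP.
have sol_key q ab : ab \in keys l m -> 
    (forall x, onto l m x -> solution (syzygy_eqns d x) q) ->
    forall x, x \in block ab.1 ab.2 -> solution (syzygy_eqns d x) q.
  by move=> ab_ks sol_q x x_blk; apply: sol_q; case: (block_key ab x ab_ks x_blk).
split=> [x /mem_fs[ab ab_ks x_F] | q sol_q q_fs x x_onto | g].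
- have [F_block _ _] := F_free _ ab_ks.
  by have [] := block_key ab x ab_ks (F_block _ x_F).
- have [x_ks x_blk] := key_block _ x_onto.
  have [_ uniq_q _] := F_free _ x_ks.
  apply: uniq_q x_blk => [|y y_F]; first exact: sol_key x_ks sol_q.
  by apply: q_fs; apply/mem_fs; exists (key x).
have ex_f : {in keys l m, forall ab, exists q : quad nat nat -> k,
    (forall x, x \in block ab.1 ab.2 -> solution (syzygy_eqns d x) q) /\
    {in F ab, q =1 g}}.
  by move=> ab /F_free[_ _ /(_ g)[q sol_q q_g]]; exists q.
have [f fP] := seq_choice (fun=> 0) ex_f.
exists (fun x => f (key x) x) => [x x_onto r r_x|x /mem_fs[ab ab_ks x_F]].
  have [x_ks x_blk] := key_block _ x_onto.
  have [_ _ size_al size_be] := keysP _ x_ks.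
  rewrite -((fP _ x_ks).1 x x_blk r r_x); apply: eq_value => y /hasP[ct ct_r /eqP <-].
  have ct_blk := block_closed size_al size_be x_blk r_x ct_r.
  by have [-> _] := block_key _ _ x_ks ct_blk.
have [F_block _ _] := F_free _ ab_ks.
have [-> _] := block_key ab x ab_ks (F_block _ x_F).
exact: (fP _ ab_ks).2.
Qed.

(** The factors count the semistandard tableaux of shape (2, 1, 1), (4) and (3,
    1) in which all the labels below [l] occur: in characteristic 0 the space of
    syzygies of the determinant is the sum of [S_211 (x) S_4], [S_4 (x) S_211]
    and [S_31 (x) S_31] for the general linear groups of the rows and of the
    columns. *)
Definition det_table l m : nat :=
  let u := nth 0 [:: 0; 0; 0; 3; 3] in
  let v := nth 0 [:: 0; 1; 3; 3; 1] in
  let w := nth 0 [:: 0; 0; 3; 6; 3] in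
  u l * v m + v l * u m + w l * w m.

(** One more coordinate is free when two rows occur twice each and four columns
    once each, or conversely. For the determinant the corresponding coordinate
    is killed by an equation with coefficient 2. *)
Definition perm_table l m : nat :=
  det_table l m + ((l == 2) && (m == 4)) + ((l == 4) && (m == 2)).

Definition certified two d (D : nat) l m :=
  (fun res => [&& all (solved two) res, uniq (flatten (map frees res))
                & size (flatten (map frees res)) == D]) (results d l m).

Lemma det_certified :
  all (fun l => all (fun m =>
    certified ((4 <= l) || (4 <= m))%N (-1) (det_table l m) l m)
    (iota 1 4)) (iota 1 4).
Proof. by vm_compute. Qed.

Lemma perm_certified :
  all (fun l => all (fun m => certified false 1 (perm_table l m) l m)
    (iota 1 4)) (iota 1 4).
Proof. by vm_compute. Qed.

(** * Free coordinates for any number of rows and columns *)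

Section Standardisation.
Variable I : finType.
Implicit Types (A : {set I}) (i : I).

(** Listing [A] first makes [standardise A] an injection of the whole type,
    under which the equations are preserved, that maps [A] onto the labels below
    [#|A|]. *)
Definition standard_order A := enum A ++ enum (~: A).

Definition standardise A i := index i (standard_order A).

Lemma mem_standard_order A i : i \in standard_order A.
Proof. by rewrite mem_cat !mem_enum inE orbN. Qed.

Lemma standardise_inj A : injective (standardise A).
Proof.
by move=> i j; apply: (index_inj i); apply: mem_standard_order.
Qed.

Lemma standardise_lt A i : (standardise A i < #|A|)%N = (i \in A).
Proof.
rewrite /standardise index_cat mem_enum cardE.
case: ifP => [i_A|_]; first by rewrite index_mem mem_enum.
by rewrite ltnNge leq_addr.
Qed.

Lemma standardise_nth A i0 p :
  (p < #|A|)%N -> standardise A (nth i0 (enum A) p) = p.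
Proof.
move=> p_A; rewrite /standardise index_cat mem_nth -?cardE //.
by rewrite index_uniq ?enum_uniq -?cardE.
Qed.

Lemma standardise_onto A (w : seq I) :
  w =i A -> map (standardise A) w =i iota 0 #|A|.
Proof.
move=> w_A p; rewrite mem_iota /=; apply/mapP/idP => [[i i_w ->]|p_A].
  by rewrite standardise_lt -w_A.
have /card_gt0P[i0 _] : (0 < #|A|)%N by apply: leq_ltn_trans p_A.
exists (nth i0 (enum A) p); last by rewrite standardise_nth.
by rewrite w_A -mem_enum mem_nth // -cardE.
Qed.

Lemma unstandardise_onto A i0 (w : seq nat) :
  w =i iota 0 #|A| -> map (nth i0 (enum A)) w =i A.
Proof.
move=> w_A i; apply/mapP/idP => [[p]|i_A].
  by rewrite w_A mem_iota /= => p_A ->; rewrite -mem_enum mem_nth // -cardE.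
have i_enum : i \in enum A by rewrite mem_enum.
exists (index i (enum A)); last by rewrite nth_index.
by rewrite w_A mem_iota /= cardE index_mem.
Qed.

Lemma sum_card_sets (G : nat -> nat) :
    (forall l, (4 < l)%N -> G l = 0%N) ->
  (\sum_(A : {set I}) G #|A| = \sum_(l < 5) 'C(#|I|, l) * G l)%N.
Proof.
move=> G0; pose N := (#|I| + 5)%N.
have A_lt A : (#|A| < N)%N by rewrite /N addnS ltnS (leq_trans (max_card _)) ?leq_addr.
rewrite (partition_big (fun A => Ordinal (A_lt A)) xpredT) //=.
rewrite [RHS](big_ord_widen N (fun l => 'C(#|I|, l) * G l)%N) ?leq_addl //.
rewrite [RHS]big_mkcond; apply: eq_bigr => l _ /=.
rewrite (eq_bigr (fun=> G l)) => [|A /eqP <- //]; rewrite sum_nat_const.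
case: ltnP => [_|l_4]; last by rewrite G0 ?muln0.
rewrite -card_draws; congr (_ * _)%N; apply: eq_card => A.
by rewrite !inE.
Qed.

End Standardisation.

Lemma relabel_comp I J I1 J1 I2 J2 (f1 : I -> I1) (g1 : J -> J1)
    (f2 : I1 -> I2) (g2 : J1 -> J2) x :
  relabel f2 g2 (relabel f1 g1 x) = relabel (f2 \o f1) (g2 \o g1) x.
Proof. by case: x => -[a b] [c e]. Qed.

Lemma relabel_id_in (I J : eqType) (f : I -> I) (g : J -> J) x :
    {in rows x, f =1 id} -> {in cols x, g =1 id} -> relabel f g x = x.
Proof.
case: x => -[[a1 a2] [b1 b2]] [[c1 c2] [e1 e2]] /= f_id g_id.
by rewrite /= !f_id ?g_id ?inE ?eqxx ?orbT.
Qed.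

Lemma relabel_inj (I J I' J' : eqType) (f : I -> I') (g : J -> J') :
  injective f -> injective g -> injective (relabel f g).
Proof.
move=> inj_f inj_g [[[a1 a2] [b1 b2]] [[c1 c2] [e1 e2]]].
case=> [[[a1' a2'] [b1' b2']] [[c1' c2'] [e1' e2']]] /=.
by case=> /inj_f-> /inj_g-> /inj_f-> /inj_g-> /inj_f-> /inj_g-> /inj_f-> /inj_g->.
Qed.

Section Assembly.
Variables (k : fieldType) (d : int) (I J : finType).
Variables (table : nat -> nat -> nat) (two : nat -> nat -> bool).
Hypothesis two_neq0 : forall l m, (l <= #|I|)%N -> (m <= #|J|)%N ->
  two l m -> (2 : k) != 0.
Hypothesis table_certified : all (fun l => all (fun m =>
  certified (two l m) d (table l m) l m) (iota 1 4)) (iota 1 4).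
Implicit Type x : quad I J.

Definition row_set x := [set i in rows x].
Definition col_set x := [set j in cols x].

Definition standard x := relabel (standardise (row_set x)) (standardise (col_set x)) x.

Definition standard_coordinates l m := flatten (map frees (results d l m)).

Definition free_quads : {set quad I J} :=
  [set x | standard x \in standard_coordinates #|row_set x| #|col_set x|].

Lemma card_row_set x : (0 < #|row_set x| <= 4)%N.
Proof.
rewrite cardsE (leq_trans (card_size _)) ?andbT; last by case: (x) => -[? ?] [].
by apply/card_gt0P; case: (x) => -[a b] [c e]; exists a.1; rewrite mem_head.
Qed.

Lemma card_col_set x : (0 < #|col_set x| <= 4)%N.
Proof.
rewrite cardsE (leq_trans (card_size _)) ?andbT; last by case: (x) => -[? ?] [].
by apply/card_gt0P; case: (x) => -[a b] [c e]; exists a.2; rewrite mem_head.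
Qed.

Lemma standard_onto x : onto #|row_set x| #|col_set x| (standard x).
Proof.
by split; rewrite ?rows_relabel ?cols_relabel; apply: standardise_onto => i;
  rewrite inE.
Qed.

Lemma onto_standard (A : {set I}) (B : {set J}) y :
    (0 < #|A|)%N -> (0 < #|B|)%N -> onto #|A| #|B| y ->
  exists x, [/\ row_set x = A, col_set x = B & standard x = y].
Proof.
case/card_gt0P=> i0 _ /card_gt0P[j0 _] [y_A y_B].
pose x := relabel (nth i0 (enum A)) (nth j0 (enum B)) y.
have x_A : row_set x = A.
  by apply/setP=> i; rewrite inE rows_relabel unstandardise_onto.
have x_B : col_set x = B.
  by apply/setP=> i; rewrite inE cols_relabel unstandardise_onto.
exists x; split=> //; rewrite /standard x_A x_B relabel_comp relabel_id_in //.
  by move=> p; rewrite y_A mem_iota /= => p_A; rewrite standardise_nth.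
by move=> p; rewrite y_B mem_iota /= => p_B; rewrite standardise_nth.
Qed.

Lemma standard_inj x x' :
    row_set x = row_set x' -> col_set x = col_set x' -> standard x = standard x' ->
  x = x'.
Proof.
rewrite /standard => -> -> /relabel_inj-> //; exact: standardise_inj.
Qed.

(** The transport of [q] along [standard] on the piece given by [A] and [B]. The
    inverse image is picked, so that no default row or column is needed. *)
Definition unstandard (A : {set I}) (B : {set J}) (q : quad I J -> k) y : k :=
  if [pick x | [&& row_set x == A, col_set x == B & standard x == y]] is Some x
  then q x else 0.

Lemma unstandardE q x : unstandard (row_set x) (col_set x) q (standard x) = q x.
Proof.
rewrite /unstandard; case: pickP => [x' /and3P[/eqP A /eqP B /eqP x'_x]|/(_ x)].
  by rewrite (standard_inj A B x'_x).
by rewrite !eqxx.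
Qed.

Lemma certifiedP l m :
    (0 < l <= 4)%N -> (0 < m <= 4)%N -> (l <= #|I|)%N -> (m <= #|J|)%N ->
  [/\ free_coordinates k d (onto l m) (standard_coordinates l m),
      uniq (standard_coordinates l m)
    & size (standard_coordinates l m) = table l m].
Proof.
move=> l_4 m_4 l_I m_J.
have := allP table_certified l; rewrite mem_iota => /(_ l_4) /allP /(_ m).
rewrite mem_iota => /(_ m_4) /and3P[solved_lm uniq_lm /eqP size_lm]; split=> //.
by apply: results_sound solved_lm _; apply: two_neq0.
Qed.

Lemma certified_sets x :
  [/\ free_coordinates k d (onto #|row_set x| #|col_set x|)
        (standard_coordinates #|row_set x| #|col_set x|),
      uniq (standard_coordinates #|row_set x| #|col_set x|)
    & size (standard_coordinates #|row_set x| #|col_set x|) =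
        table #|row_set x| #|col_set x|].
Proof. by apply: certifiedP; rewrite ?card_row_set ?card_col_set ?max_card. Qed.

Lemma row_set_perm x y : perm_eq (rows y) (rows x) -> row_set y = row_set x.
Proof. by move/perm_mem=> eq_yx; apply/setP=> i; rewrite !inE eq_yx. Qed.

Lemma col_set_perm x y : perm_eq (cols y) (cols x) -> col_set y = col_set x.
Proof. by move/perm_mem=> eq_yx; apply/setP=> i; rewrite !inE eq_yx. Qed.

Lemma standard_eqns x (q : quad I J -> k) (q' : quad nat nat -> k) :
    (forall y, row_set y = row_set x -> col_set y = col_set x ->
      q y = q' (standard y)) ->
  solution (syzygy_eqns d x) q <-> solution (syzygy_eqns d (standard x)) q'.
Proof.
move=> qq'; have value_qq' r : r \in syzygy_eqns d x ->
    value q r = value q' [seq (ct.1, relabel (standardise (row_set x))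
                                 (standardise (col_set x)) ct.2) | ct <- r].
  move=> r_x; rewrite value_relabel; apply: eq_value => y /hasP[ct ct_r /eqP <-].
  have [/row_set_perm A /col_set_perm B] := syzygy_eqns_content r_x ct_r.
  by rewrite qq' // /standard A B.
rewrite /standard syzygy_eqns_relabel; do ?exact: standardise_inj.
split=> sol r; first by case/mapP=> r' r'_x ->; rewrite -value_qq' // sol.
by move=> r_x; rewrite value_qq' // sol // map_f.
Qed.

(** On the piece with rows [A] and columns [B], standardisation turns the system
    into the one that has been solved for [#|A|] and [#|B|] labels. *)
Theorem free_quads_coordinates :
  free_coordinates k d (fun=> True) (enum free_quads).
Proof.
split=> // [q sol_q q_free x0 _ | g].
  have [[_ uniq_q _] _ _] := certified_sets x0.
  have /andP[A_gt0 _] := card_row_set x0; have /andP[B_gt0 _] := card_col_set x0.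
  pose q' := unstandard (row_set x0) (col_set x0) q.
  have q'E x : row_set x = row_set x0 -> col_set x = col_set x0 ->
    q x = q' (standard x) by rewrite /q' => <- <-; rewrite unstandardE.
  rewrite q'E // uniq_q //; last exact: standard_onto.
    move=> y /onto_standard[//|//|x [A B <-]].
    apply: (iffLR (standard_eqns _) (sol_q x Logic.I)) => z; rewrite A B; exact: q'E.
  move=> y y_fs; have [[fs_onto _ _] _ _] := certified_sets x0.
  have [//|//|x [A B def_y]] := onto_standard _ _ (fs_onto _ y_fs).
  rewrite -def_y -q'E // q_free // mem_enum inE A B; by rewrite def_y.
have ex_f (AB : {set I} * {set J}) : exists q : quad nat nat -> k,
    forall x, AB = (row_set x, col_set x) ->
    (forall y, onto #|AB.1| #|AB.2| y -> solution (syzygy_eqns d y) q) /\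
    {in standard_coordinates #|AB.1| #|AB.2|, q =1 unstandard AB.1 AB.2 g}.
  case: (pickP (fun x => AB == (row_set x, col_set x))) => [x0 /eqP->|AB0].
    have [[_ _ /(_ (unstandard (row_set x0) (col_set x0) g))[q sol_q q_g]] _ _] :=
      certified_sets x0.
    by exists q.
  by exists (fun=> 0) => x /eqP; rewrite AB0.
have [f fP] := fin_all_exists ex_f.
exists (fun x => f (row_set x, col_set x) (standard x)) => [x _|x].
  have [sol_f _] := fP _ x erefl; have sol_x := sol_f _ (standard_onto x).
  by apply: (iffRL (standard_eqns _) sol_x) => y -> ->.
rewrite mem_enum inE => x_fs; have [_ f_g] := fP _ x erefl.
by rewrite f_g //= unstandardE.
Qed.

Theorem card_free_quads :
  #|free_quads| =
    (\sum_(l < 5) \sum_(m < 5) 'C(#|I|, l) * 'C(#|J|, m) *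
       (if (0 < l) && (0 < m) then table l m else 0))%N.
Proof.
pose G l m := (if (0 < l <= 4) && (0 < m <= 4) then table l m else 0)%N.
transitivity (\sum_(A : {set I}) \sum_(B : {set J}) G #|A| #|B|)%N.
  rewrite -sum1_card (partition_big row_set xpredT) //=; apply: eq_bigr => A _.
  rewrite (partition_big col_set xpredT) //=; apply: eq_bigr => B _.
  rewrite sum1dep_card; set S := [set x | _].
  have SP x : (x \in S) = [&& x \in free_quads, row_set x == A & col_set x == B].
    by rewrite inE andbA.
  rewrite /G; case: ifP => [/andP[A_4 B_4]|noAB]; last first.
    apply: eq_card0 => x; rewrite SP; apply/and3P=> -[_ /eqP A_x /eqP B_x].
    by move: noAB; rewrite -A_x -B_x card_row_set card_col_set.
  have [[fs_onto _ _] uniq_fs <-] := certifiedP A_4 B_4 (max_card A) (max_card B).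
  have [A_gt0 B_gt0] : (0 < #|A|)%N /\ (0 < #|B|)%N.
    by case/andP: A_4; case/andP: B_4.
  rewrite cardE -(size_map standard); apply/perm_size/uniq_perm => // [|y].
    rewrite map_inj_in_uniq ?enum_uniq // => x x'; rewrite !mem_enum !SP.
    by case/and3P=> _ /eqP A_x /eqP B_x /and3P[_ /eqP A_x' /eqP B_x'];
      apply: standard_inj; rewrite ?A_x ?B_x.
  apply/mapP/idP => [[x]|y_fs].
    rewrite mem_enum SP inE => /and3P[x_fs /eqP A_x /eqP B_x] ->.
    by rewrite A_x B_x in x_fs.
  have [x [A_x B_x def_y]] := onto_standard A_gt0 B_gt0 (fs_onto _ y_fs).
  by exists x; rewrite // mem_enum SP inE A_x B_x def_y y_fs !eqxx.
have G_sum l : (\sum_(B : {set J}) G l #|B| = \sum_(m < 5) 'C(#|J|, m) * G l m)%N.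
  by apply: sum_card_sets => m m_4; rewrite /G [(m <= 4)%N]leqNgt m_4 /= !andbF.
under eq_bigr => A _ do rewrite G_sum.
rewrite (sum_card_sets I (G := fun l => \sum_(m < 5) 'C(#|J|, m) * G l m)%N);
  last first.
  move=> l l_4; apply: big1 => m _.
  by rewrite /G [(l <= 4)%N]leqNgt l_4 andbF muln0.
apply: eq_bigr => l _; rewrite big_distrr; apply: eq_bigr => m _ /=.
by rewrite mulnA /G -[(l <= 4)%N]ltnS -[(m <= 4)%N]ltnS !ltn_ord !andbT.
Qed.
End Assembly.

(** * Coefficients of products and homogeneous polynomials *)

Section Coefficients.
Variables (k : fieldType) (N : nat).
Implicit Types (p q : {mpoly k[N]}) (m : 'X_{1..N}) (i j : 'I_N).

Lemma mcoeffXM i p m :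
  ('X_i * p)@_m = if m i != 0%N then p@_(m - U_(i)) else 0.
Proof.
rewrite mulrC; case: ifP => [m_i|/negbFE/eqP m_i].
  have m_ge : (U_(i) <= m)%MM by rewrite lep1mP.
  by rewrite -{1}(submK m_ge) addmC mcoeffMX.
apply/memN_msupp_eq0; rewrite (perm_mem (msuppMX _ _)).
apply/mapP => -[m' _ def_m]; move: m_i.
by rewrite def_m mnmDE mnm1E eqxx.
Qed.

Lemma dhomog_coef0 d p m : p \is d.-homog -> mdeg m != d -> p@_m = 0.
Proof. exact: dhomog_nemf_coeff. Qed.

Lemma mcoeffM_ldegree d p q m :
  q \is d.-homog -> (mdeg m < d)%N -> (p * q)@_m = 0.
Proof.
move=> q_d m_d; rewrite mcoeffM big1 // => -[m1 m2] /=.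
move: (bmnm m1) (bmnm m2) => {}m1 {}m2 /eqP /(congr1 mdeg).
rewrite mdegD => def_m; rewrite (dhomog_coef0 q_d) ?mulr0 //.
by apply: contraTneq m_d => <-; rewrite -leqNgt def_m leq_addl.
Qed.

(** In the degree of [q], only the constant term of [p] can contribute. *)
Lemma mcoeffM_lead d p q m :
  q \is d.-homog -> mdeg m = d -> (p * q)@_m = p@_0%MM * q@_m.
Proof.
move=> q_d m_d; rewrite -[p in LHS](subrK (p@_0%MM)%:MP) mulrDl mcoeffD mcoeffCM.
rewrite mcoeffM big1 ?add0r // => -[m1 m2] /=.
move: (bmnm m1) (bmnm m2) => {}m1 {}m2 /eqP /(congr1 mdeg).
rewrite mdegD m_d => def_m; have [m1_0|m1_0] := eqVneq m1 0%MM.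
  by rewrite m1_0 mcoeffB mcoeffC eqxx mulr1 subrr mul0r.
rewrite (dhomog_coef0 q_d) ?mulr0 //; apply: contraNneq m1_0 => m2_d.
by rewrite -mdeg_eq0 -(eqn_add2r (mdeg m2)) -def_m m2_d.
Qed.

Lemma dhomog0_const p : p \is 0.-homog -> p = (p@_0%MM)%:MP.
Proof.
move=> p_0; apply/mpolyP => m; rewrite mcoeffC.
case: eqP => [->|/eqP m_0]; first by rewrite mulr1.
by rewrite mulr0 (dhomog_coef0 p_0) // mdeg_eq0.
Qed.

Lemma mnm_mdegS m d : mdeg m = d.+1 -> exists i m', m = (U_(i) + m')%MM /\ mdeg m' = d.
Proof.
move=> m_d; have [i m_i] : exists i, m i != 0%N.
  apply/existsP; rewrite -negb_forall; apply/forallP => m_0.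
  have := m_d; rewrite mdegE big1 // => i _; exact/eqP.
have m_ge : (U_(i) <= m)%MM by rewrite lep1mP.
exists i, (m - U_(i))%MM; rewrite addmC submK //; split=> //.
by move: m_d; rewrite -{1}(submK m_ge) mdegD mdeg1 addn1 => -[].
Qed.

Lemma mnm_mdeg1 m : mdeg m = 1%N -> exists i, m = U_(i)%MM.
Proof. by move/eqP/mdeg1P => [i /eqP]; exists i. Qed.

Lemma mnm_mdeg2 m : mdeg m = 2%N -> exists i j, m = (U_(i) + U_(j))%MM.
Proof. by case/mnm_mdegS=> i [m' [-> /mnm_mdeg1[j ->]]]; exists i, j. Qed.

Lemma mnm_U2_inj i j i' j' :
  (U_(i) + U_(j) = U_(i') + U_(j'))%MM -> (i = i' /\ j = j') \/ (i = j' /\ j = i').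
Proof.
move=> eq_ij; have U_inj := fun i j (eqU : U_(i)%MM = U_(j)%MM :> 'X_{1..N}) =>
  elimT eqP (etrans (esym (eq_mnm1 i j)) (introT eqP eqU)).
have [ii'|i_i'] := eqVneq i i'.
  by left; split=> //; apply/U_inj/(@addmI _ U_(i)%MM); rewrite eq_ij ii'.
have ij' : i = j'.
  apply/eqP; apply: contraTT (eqxx ((U_(i) + U_(j)) i)%MM) => i_j'.
  rewrite {1}eq_ij !mnmDE !mnm1E eqxx [i' == i]eq_sym [j' == i]eq_sym.
  by rewrite (negPf i_i') (negPf i_j').
right; split=> //; apply/U_inj/(@addmI _ U_(i)%MM).
by rewrite eq_ij ij' addmC.
Qed.

Lemma dhomog_ext d p q :
    p \is d.-homog -> q \is d.-homog ->
    (forall m, mdeg m = d -> p@_m = q@_m) -> p = q.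
Proof.
move=> p_d q_d pq; apply/mpolyP => m; have [/pq //|m_d] := eqVneq (mdeg m) d.
by rewrite (dhomog_coef0 p_d) ?(dhomog_coef0 q_d).
Qed.

(** A symmetric array is the array of coefficients of a quadratic form in the
    basis of monomials: its off-diagonal entries are not halved. *)
Lemma quadric_of_coefficients (f : 'I_N -> 'I_N -> k) :
    (forall i j, f i j = f j i) ->
  exists2 p : {mpoly k[N]}, p \is 2.-homog
    & forall i j, p@_(U_(i) + U_(j)) = f i j.
Proof.
move=> fC; pose F (m : 'X_{1..N}) :=
  if [pick ij : 'I_N * 'I_N | m == (U_(ij.1) + U_(ij.2))%MM] is Some ij
  then f ij.1 ij.2 else 0.
exists (\sum_(m : 'X_{1..N < 3}) F m *: 'X_[m]).
  apply/dhomogP => m; rewrite mcoeff_msupp.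
  have [m_3|m_3] := ltnP (mdeg m) 3.
    rewrite mcoeff_mpoly // /F; case: pickP => [ij /eqP-> _|_]; last by rewrite eqxx.
    by rewrite /= mdegD !mdeg1.
  rewrite raddf_sum big1 ?eqxx // => m' _.
  rewrite /= mcoeffZ mcoeffX; case: eqP => [eq_m|]; last by rewrite mulr0.
  by have := bmdeg m'; rewrite eq_m ltnNge m_3.
move=> i j; rewrite mcoeff_mpoly ?mdegD ?mdeg1 // /F.
case: pickP => [[i' j'] /= /eqP/mnm_U2_inj[[-> ->]|[-> ->]] //|/(_ (i, j))].
by rewrite eqxx.
Qed.

End Coefficients.

(** * Quadrics apolar to the determinant and the permanent *)

Section ContractionCoefficients.
Variables (k : fieldType) (N : nat).
Implicit Types (f g : {mpoly k[N]}) (m : 'X_{1..N}).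

Lemma mcoeff_contract g f m :
  (contract g f)@_m = \sum_(m1 <- msupp g) g@_m1 * f@_(m1 + m).
Proof.
rewrite raddf_sum; apply: eq_bigr => m1 _ /=; rewrite raddf_sum /=.
have termE a : ((g@_m1 * f@_a) *: (if (m1 <= a)%MM then 'X_[a - m1] else 0))@_m =
    if a == (m1 + m)%MM then g@_m1 * f@_a else 0.
  rewrite mcoeffZ; case: ifP => [m1_a|m1_a].
    rewrite mcoeffX -(eqm_add2r m1) submK // [(m + m1)%MM]addmC.
    by case: eqP => _; rewrite ?mulr1 ?mulr0.
  rewrite mcoeff0 mulr0; case: eqP => // a_m1.
  by rewrite a_m1 lem_addr in m1_a.
under eq_bigr => a _ do rewrite termE.
have [supp_m|/memN_msupp_eq0 f_m] := boolP ((m1 + m)%MM \in msupp f).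
  by rewrite (bigD1_seq _ supp_m) //= eqxx big1 ?addr0 // => a /negPf->.
by rewrite f_m mulr0 big1 // => a _; case: eqP => [->|//]; rewrite f_m mulr0.
Qed.

(** The sum giving a coefficient of a contraction can be taken over any finite set
    of monomials that contains those contributing to it. *)
Lemma mcoeff_contract_seq g f m (ms : seq 'X_{1..N}) :
    uniq ms -> (forall m1, g@_m1 != 0 -> f@_(m1 + m) != 0 -> m1 \in ms) ->
  (contract g f)@_m = \sum_(m1 <- ms) g@_m1 * f@_(m1 + m).
Proof.
move=> uniq_ms sub_ms; rewrite mcoeff_contract.
rewrite (bigID (mem ms)) /= [X in _ + X]big1_seq ?addr0; last first.
  move=> m1 /andP[m1_ms]; rewrite mcoeff_msupp => g_m1.
  have [->|f_m1] := eqVneq (f@_(m1 + m)) 0; first by rewrite mulr0.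
  by rewrite sub_ms in m1_ms.
rewrite [RHS](bigID (mem (msupp g))) /= [X in _ = _ + X]big1_seq ?addr0.
  rewrite -big_filter -[RHS]big_filter; apply: perm_big.
  apply: uniq_perm; rewrite ?filter_uniq ?msupp_uniq //.
  by move=> m1; rewrite !mem_filter /= andbC.
by move=> m1 /andP[/memN_msupp_eq0-> _]; rewrite mul0r.
Qed.

End ContractionCoefficients.

Lemma perm_agree_off2 (T : finType) (s s' : {perm T}) (x y : T) :
    (forall z, z != x -> z != y -> s' z = s z) -> s' = s \/ s' = (tperm x y * s)%g.
Proof.
case: (eqVneq y x) => [->|xy] ss'.
  left; apply/permP=> z; have [->|z_x] := eqVneq z x; last exact: ss'.
  have [w s_w] : exists w, s' w = s x by exists (s'^-1 (s x))%g; rewrite permKV.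
  have [w_x|w_x] := eqVneq w x; first by rewrite -s_w w_x.
  by case/eqP: (w_x); apply: (@perm_inj _ s); rewrite -ss'.
have s'_xy z : z \in [:: x; y] -> s' z \in [:: s x; s y].
  move=> z_xy; have [w s_w] : exists w, s w = s' z.
    by exists (s^-1 (s' z))%g; rewrite permKV.
  have [w_xy|w_xy] := boolP (w \in [:: x; y]).
    by rewrite -s_w (map_f s w_xy).
  move: (w_xy); rewrite !inE negb_or => /andP[w_x w_y].
  have zw : z = w by apply: (@perm_inj _ s'); rewrite (ss' w).
  by rewrite -zw z_xy in w_xy.
have s'x := s'_xy x (mem_head _ _).
have s'y : s' y \in [:: s x; s y] by apply: s'_xy; rewrite !inE eqxx orbT.
have s'_neq : s' x != s' y by rewrite (inj_eq perm_inj) eq_sym.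
move: s'x s'y s'_neq; rewrite !inE => /orP[] /eqP s'x /orP[] /eqP s'y;
  rewrite s'x s'y ?eqxx // => _.
  left; apply/permP=> z; have [->//|z_x] := eqVneq z x.
  by have [->//|z_y] := eqVneq z y; apply: ss'.
right; apply/permP=> z; rewrite permM; case: tpermP => [->|->|/eqP z_x /eqP z_y] //.
exact: ss'.
Qed.

Section Apolar.
Variables (k : fieldType) (n : nat) (e : k).
Hypothesis e_sqr : e * e = 1.
Local Notation N := (n * n)%N.
Local Notation U c := (U_(mxvec_index c.1 c.2))%MM.
Implicit Types (g : {mpoly k[N]}) (m : 'X_{1..N}) (s : 'S_n) (c : 'I_n * 'I_n).

Definition perm_mnm s : 'X_{1..N} := (\sum_i U_(mxvec_index i (s i)))%MM.

Definition signed_permanent : {mpoly k[N]} :=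
  \sum_(s : 'S_n) e ^+ odd_perm s *: 'X_[perm_mnm s].

Lemma cell_index_inj c c' :
  mxvec_index c.1 c.2 = mxvec_index c'.1 c'.2 -> c = c'.
Proof. by case: c c' => [i j] [i' j'] /cast_ord_inj/enum_rank_inj. Qed.

Lemma perm_mnmE s i j : perm_mnm s (mxvec_index i j) = (s i == j) :> nat.
Proof.
have idx_eq i1 j1 : (mxvec_index i1 j1 == mxvec_index i j) = (i1 == i) && (j1 == j).
  by apply/eqP/andP => [/(@cell_index_inj (i1, j1) (i, j))[-> ->]|[/eqP-> /eqP->]].
rewrite mnm_sumE (bigD1 i) //= mnm1E idx_eq eqxx big1 ?addn0 // => i1 /negPf i1_i.
by rewrite mnm1E idx_eq i1_i.
Qed.

Lemma perm_mnm_inj : injective perm_mnm.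
Proof.
move=> s s' eq_ss'; apply/permP=> i; apply/eqP; rewrite eq_sym.
by have := perm_mnmE s' i (s i); rewrite -eq_ss' perm_mnmE eqxx; case: eqP.
Qed.

Lemma mcoeff_signed_permanent s :
  signed_permanent@_(perm_mnm s) = e ^+ odd_perm s.
Proof.
rewrite raddf_sum (bigD1 s) //= mcoeffZ mcoeffX eqxx mulr1 big1 ?addr0 // => s' s's.
by rewrite mcoeffZ mcoeffX (inj_eq perm_mnm_inj) (negPf s's) mulr0.
Qed.

Lemma mcoeff_signed_permanent_neq0 m :
  signed_permanent@_m != 0 -> exists s, m = perm_mnm s.
Proof.
case: (pickP (fun s => perm_mnm s == m)) => [s /eqP<-|no_s]; first by exists s.
rewrite raddf_sum big1 ?eqxx // => s _.
by rewrite /= mcoeffZ mcoeffX no_s mulr0.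
Qed.

Lemma perm_mnm_agree s s' m m1 m1' i :
    (m1 + m)%MM = perm_mnm s -> (m1' + m)%MM = perm_mnm s' ->
  m1 (mxvec_index i (s i)) = 0%N -> s' i = s i.
Proof.
move=> def_s def_s' m1_i; apply/eqP.
have := perm_mnmE s i (s i); rewrite -def_s mnmDE m1_i eqxx add0n => m_i.
have := perm_mnmE s' i (s i); rewrite -def_s' mnmDE m_i.
by case: eqP => //; rewrite addn1.
Qed.

Lemma sign_neq0 s : e ^+ odd_perm s != 0.
Proof.
apply: expf_neq0; apply: contra_eq_neq e_sqr => ->.
by rewrite mul0r eq_sym oner_eq0.
Qed.

Lemma apolar_mcoeff g m : g \in apolar signed_permanent ->
  (contract g signed_permanent)@_m = 0.
Proof. by rewrite inE => /eqP->; rewrite mcoeff0. Qed.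

Lemma mdeg_perm_mnm s : mdeg (perm_mnm s) = n.
Proof.
rewrite mdeg_sum (eq_bigr (fun=> 1%N)) => [|i _]; last exact: mdeg1.
by rewrite sum1_card card_ord.
Qed.

(** The only monomial of a permutation divisible by another one is this one
    itself. *)
Lemma apolar_mcoeff0 g : g \in apolar signed_permanent -> g@_0%MM = 0.
Proof.
move=> /(apolar_mcoeff (perm_mnm 1%g)).
rewrite (@mcoeff_contract_seq _ _ _ _ _ [:: 0%MM]) // => [|m1 _].
  rewrite big_seq1 add0m mcoeff_signed_permanent => /eqP.
  by rewrite mulf_eq0 (negPf (sign_neq0 _)) orbF => /eqP.
case/mcoeff_signed_permanent_neq0=> s /(congr1 mdeg) /eqP.
by rewrite mdegD !mdeg_perm_mnm -[X in _ == X]add0n eqn_add2r mdeg_eq0 inE.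
Qed.

(** A permutation is determined by its values at all points but one, so every
    monomial of degree at most 1 has a cofactor of which it is the only
    complement. *)
Lemma apolar_ldegree g d :
  g \in apolar signed_permanent -> g \is d.-homog -> (d < 2)%N -> g = 0.
Proof.
move=> g_I g_d d_2; apply/mpolyP => m0; rewrite mcoeff0.
have [m0_d|m0_d] := eqVneq (mdeg m0) d; last exact: dhomog_coef0 g_d m0_d.
have [s [m def_s s_uniq]] : exists s, exists2 m, (m0 + m)%MM = perm_mnm s &
    forall s' m1, (m1 + m)%MM = perm_mnm s' -> s' = s.
  case: d d_2 m0_d {g_d} => [|[|//]] _ => [/eqP|/mnm_mdeg1[a ->]].
    rewrite mdeg_eq0 => /eqP->; exists 1%g, (perm_mnm 1%g); first by rewrite add0m.
    move=> s' m1 def_s'; apply/permP=> i.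
    by apply: perm_mnm_agree (add0m _) def_s' _; rewrite mnm0E.
  case/mxvec_indexP: a => i j; pose s := tperm i j.
  have def_s : (U (i, j) + (perm_mnm s - U (i, j)))%MM = perm_mnm s.
    by rewrite addmC submK // lep1mP perm_mnmE tpermL eqxx.
  exists s, (perm_mnm s - U (i, j))%MM => // s' m1 def_s'.
  have [z z_i _|//|->] := @perm_agree_off2 _ s s' i i.
    apply: perm_mnm_agree def_s def_s' _; rewrite mnm1E.
    by case: eqP => // /(@cell_index_inj (i, j) (z, s z))[i_z]; rewrite i_z eqxx in z_i.
  by rewrite tperm1 mul1g.
have agree m1 : g@_m1 != 0 -> signed_permanent@_(m1 + m) != 0 -> m1 \in [:: m0].
  move=> _ /mcoeff_signed_permanent_neq0[s' def_s'].
  by rewrite inE -(eqm_add2r m) def_s def_s' (s_uniq _ _ def_s').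
have := apolar_mcoeff m g_I.
rewrite (mcoeff_contract_seq _ agree) // big_seq1 def_s mcoeff_signed_permanent.
by move/eqP; rewrite mulf_eq0 (negPf (sign_neq0 s)) orbF => /eqP.
Qed.

(** If the product of a monomial with the complement of the cells [(i, s i)] and
    [(i', s i')] is the monomial of a permutation, this permutation agrees with
    [s] except at [i] and [i'], so it is [s] or its composite with the
    transposition of [i] and [i']. Hence only two coefficients of [g]
    contribute, with opposite signs for the determinant. *)
Lemma contract_quadric g s i i' :
    g \is 2.-homog -> i != i' ->
    let m0 := (U (i, s i) + U (i', s i'))%MM in
    let m0' := (U (i, s i') + U (i', s i))%MM in
  (contract g signed_permanent)@_(perm_mnm s - m0)%MM =
    e ^+ odd_perm s * (g@_m0 + e * g@_m0').
Proof.
move=> g_2 i_i' m0 m0'; set m := (_ - _)%MM.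
have U_idx (j l j' l' : 'I_n) :
    U (j, l) (mxvec_index j' l') = ((j == j') && (l == l')) :> nat.
  rewrite mnm1E; congr (nat_of_bool _); apply/eqP/andP.
    by move/(@cell_index_inj (j, l) (j', l'))=> [-> ->].
  by case=> /eqP-> /eqP->.
have def_s : (m0 + m)%MM = perm_mnm s.
  rewrite addmC submK //; apply/mnm_lepP => a; case/mxvec_indexP: a => j l.
  rewrite mnmDE !U_idx perm_mnmE.
  have [<-|_] /= := eqVneq i j; first by rewrite [i' == i]eq_sym (negPf i_i') addn0.
  by have [<-|_] := eqVneq i' j.
pose s' := (tperm i i' * s)%g.
have def_s' : (m0' + m)%MM = perm_mnm s'.
  apply/mnmP => a; case/mxvec_indexP: a => j l.
  have := congr1 (fun m1 : 'X_{1..N} => m1 (mxvec_index j l)) def_s.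
  rewrite !mnmDE !U_idx !perm_mnmE permM.
  case: tpermP => [->|->|/eqP j_i /eqP j_i'].
  - rewrite eqxx [i' == i]eq_sym (negPf i_i') /= !addn0.
    by case: (s i == l); case: (s i' == l) => /=; move: (fun_of_multinom m _) => x; lia.
  - rewrite eqxx (negPf i_i') /=.
    by case: (s i == l); case: (s i' == l) => /=; move: (fun_of_multinom m _) => x; lia.
  - by rewrite ![_ == j]eq_sym (negPf j_i) (negPf j_i').
have odd_s' : e ^+ odd_perm s' = e * e ^+ odd_perm s.
  rewrite /s' odd_permM odd_tperm i_i' /=.
  by case: (odd_perm s); rewrite ?expr1 ?expr0 ?mulr1 ?e_sqr.
have agree m1 : g@_m1 != 0 -> signed_permanent@_(m1 + m) != 0 -> m1 \in [:: m0; m0'].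
  move=> _ /mcoeff_signed_permanent_neq0[s1 def_s1]; rewrite !inE.
  have [z z_i z_i'|s1_s|s1_s'] := @perm_agree_off2 _ s s1 i i'.
  - apply: perm_mnm_agree def_s def_s1 _; rewrite mnmDE !U_idx.
    by rewrite ![_ == z]eq_sym (negPf z_i) (negPf z_i').
  - by rewrite -(eqm_add2r m) def_s def_s1 s1_s eqxx.
  - by rewrite -[m1 == m0'](eqm_add2r m) def_s' def_s1 s1_s' eqxx orbT.
rewrite (mcoeff_contract_seq _ agree).
  rewrite !big_cons big_nil addr0 def_s def_s' !mcoeff_signed_permanent odd_s'.
  by rewrite mulrDr [e ^+ _ * g@_m0]mulrC [g@_m0' * _]mulrC mulrCA mulrA.
rewrite /= andbT inE; apply/eqP=> /mnm_U2_inj [] [] /cell_index_inj [].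
  by move/perm_inj=> ii'; rewrite ii' eqxx in i_i'.
by move=> ii'; rewrite ii' eqxx in i_i'.
Qed.

Theorem apolar_quadric g :
    g \is 2.-homog ->
  (g \in apolar signed_permanent <->
   forall c c', c.1 != c'.1 -> c.2 != c'.2 ->
     g@_(U c + U c') + e * g@_(U (c.1, c'.2) + U (c'.1, c.2)) = 0).
Proof.
move=> g_2; split=> [g_I [i j] [i' j'] /= i_i' j_j' | g_rel].
  pose s := (tperm i j * tperm (tperm i j i') j')%g.
  have s_i : s i = j.
    rewrite permM tpermL tpermD //; last by rewrite eq_sym.
    by rewrite -[X in _ != X](tpermL i j) (inj_eq perm_inj) eq_sym.
  have s_i' : s i' = j' by rewrite permM tpermL.
  have := apolar_mcoeff (perm_mnm s - (U (i, s i) + U (i', s i')))%MM g_I.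
  rewrite contract_quadric // s_i s_i' => /eqP.
  by rewrite mulf_eq0 (negPf (sign_neq0 s)) => /eqP.
rewrite inE; apply/eqP/mpolyP => m; rewrite mcoeff0.
have [/existsP[s /existsP[[i i']]]|] :=
    boolP [exists s, [exists ii' : 'I_n * 'I_n, (ii'.1 != ii'.2) &&
      (m == perm_mnm s - (U (ii'.1, s ii'.1) + U (ii'.2, s ii'.2)))%MM]].
  case/andP=> /= i_i' /eqP->; rewrite contract_quadric // g_rel ?mulr0 //=.
  by rewrite (inj_eq perm_inj).
move=> no_s; rewrite (@mcoeff_contract_seq _ _ _ _ _ [::]) ?big_nil // => m1 g_m1.
case/mcoeff_signed_permanent_neq0=> s def_s; case/negP: no_s.
have m1_2 : mdeg m1 = 2%N by apply: contraNeq g_m1 => m1_2; rewrite (dhomog_coef0 g_2).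
have [a [b def_m1]] := mnm_mdeg2 m1_2.
case/mxvec_indexP: a def_m1 => i j; case/mxvec_indexP: b => i' j' def_m1.
have cell_s z l :
    (0 < m1 (mxvec_index z l))%N -> (s z == l) /\ m1 (mxvec_index z l) = 1%N.
  move=> m1_zl; have := perm_mnmE s z l; rewrite -def_s mnmDE.
  by case: eqP => //= _; lia.
have [/eqP s_i _] : (s i == j) /\ m1 (mxvec_index i j) = 1%N.
  by apply: cell_s; rewrite def_m1 mnmDE mnm1E eqxx.
have [/eqP s_i' m1_i'] : (s i' == j') /\ m1 (mxvec_index i' j') = 1%N.
  by apply: cell_s; rewrite def_m1 mnmDE !mnm1E eqxx addn1.
apply/existsP; exists s; apply/existsP; exists (i, i') => /=.
rewrite s_i s_i' -def_m1 -def_s addmC addmK eqxx andbT.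
apply: contra_eq_neq m1_i' => ii'.
by rewrite def_m1 mnmDE !mnm1E -s_i -s_i' ii' eqxx.
Qed.

End Apolar.

(** * The linear strand of a minimal resolution *)

Section QuadraticForms.
Variables (k : fieldType) (N : nat).

Lemma mcoeff_quadratic (f : 'I_N -> 'I_N -> k) c e :
  (\sum_a 'X_a * \sum_b 'X_b * (f a b)%:MP : {mpoly k[N]})@_(U_(c) + U_(e)) =
    if c == e then f c c else f c e + f e c.
Proof.
have termE a : ('X_a * \sum_b 'X_b * (f a b)%:MP : {mpoly k[N]})@_(U_(c) + U_(e)) =
    \sum_b f a b * (((a, b) == (c, e)) || ((a, b) == (e, c)))%:R.
  rewrite mulr_sumr raddf_sum; apply: eq_bigr => b _ /=.
  rewrite mulrA -mpolyXD mulrC mcoeffCM mcoeffX; congr (_ * _%:R).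
  congr (nat_of_bool _); rewrite !xpair_eqE; apply/eqP/orP.
    by move/mnm_U2_inj=> [[-> ->]|[-> ->]]; rewrite !eqxx; [left | right].
  by case=> /andP[/eqP-> /eqP->] //; rewrite addmC.
rewrite raddf_sum /=; under eq_bigr => a _ do rewrite termE.
rewrite pair_bigA /= (bigD1 (c, e)) //= eqxx mulr1.
have [<-|c_e] := eqVneq c e.
  rewrite big1 ?addr0 // => -[a b] /= /negPf->; exact: mulr0.
rewrite (bigD1 (e, c)) /= ?eqxx ?orbT ?mulr1; last first.
  by rewrite xpair_eqE eq_sym (negPf c_e).
rewrite big1 ?addr0 // => -[a b] /= /andP[/negPf-> /negPf->]; exact: mulr0.
Qed.

Lemma quadratic_homog (f : 'I_N -> 'I_N -> k) :
  (\sum_a 'X_a * \sum_b 'X_b * (f a b)%:MP : {mpoly k[N]}) \is 2.-homog.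
Proof.
apply: rpred_sum => a _; rewrite mulr_sumr; apply: rpred_sum => b _.
rewrite mulrA -mpolyXD mulrC mul_mpolyC; apply: rpredZ.
by rewrite dhomogX /= mdegD !mdeg1.
Qed.

(** Alternation has to be stated with a separate condition on the diagonal,
    because of characteristic 2. *)
Lemma quadratic_eq0 (f : 'I_N -> 'I_N -> k) :
  (\sum_a 'X_a * \sum_b 'X_b * (f a b)%:MP = 0 :> {mpoly k[N]}) <->
  (forall a, f a a = 0) /\ (forall a b, a != b -> f a b + f b a = 0).
Proof.
split=> [f0|[f_diag f_alt]].
  split=> [a|a b /negPf ab].
    by have := mcoeff_quadratic f a a; rewrite f0 mcoeff0 eqxx.
  by have := mcoeff_quadratic f a b; rewrite f0 mcoeff0 ab.
apply: (dhomog_ext (quadratic_homog f) (rpred0 _)) => m /mnm_mdeg2[c [e ->]].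
rewrite mcoeff_quadratic mcoeff0; case: eqP => [_|/eqP]; [exact: f_diag | exact: f_alt].
Qed.

Lemma linear_form (p : {mpoly k[N]}) :
  p \is 1.-homog -> p = \sum_a 'X_a * (p@_U_(a))%:MP.
Proof.
move=> p_1; apply: (dhomog_ext p_1).
  apply: rpred_sum => a _; rewrite mulrC mul_mpolyC; apply: rpredZ.
  by rewrite dhomogX /= mdeg1.
move=> m /mnm_mdeg1[a ->]; rewrite raddf_sum (bigD1 a) //= big1 => [|b b_a].
  by rewrite mulrC mcoeffCM mcoeffXU eqxx mulr1 addr0.
by rewrite mulrC mcoeffCM mcoeffXU (negPf b_a) mulr0.
Qed.
End QuadraticForms.

Section GradedMaps.
Variables (k : fieldType) (N : nat).
Local Notation S := {mpoly k[N]}.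

Definition const_row r (v : 'rV[k]_r) : 'rV[S]_r := map_mx (@mpolyC N k) v.

Definition supported r (s : 'I_r -> nat) (d : nat) (v : 'rV[k]_r) :=
  forall i, s i != d -> v 0 i = 0.

Definition linear_part r t (D : 'M[S]_(r, t)) (a : 'I_N) : 'M[k]_(r, t) :=
  map_mx (mcoeff U_(a)%MM) D.

Definition linear_row r (f : 'I_N -> 'rV[k]_r) : 'rV[S]_r :=
  \sum_a 'X_a *: const_row (f a).

Lemma linear_rowE r (f : 'I_N -> 'rV[k]_r) i :
  linear_row f 0 i = \sum_a 'X_a * (f a 0 i)%:MP.
Proof. by rewrite summxE; apply: eq_bigr => a _; rewrite !mxE. Qed.

Lemma linear_row_inj r (f h : 'I_N -> 'rV[k]_r) :
  linear_row f = linear_row h -> f =1 h.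
Proof.
have coefE (f' : 'I_N -> 'rV[k]_r) i a : (linear_row f' 0 i)@_U_(a) = f' a 0 i.
  rewrite linear_rowE raddf_sum (bigD1 a) //= big1 => [|b b_a].
    by rewrite mulrC mcoeffCM mcoeffXU eqxx mulr1 addr0.
  by rewrite mulrC mcoeffCM mcoeffXU (negPf b_a) mulr0.
by move=> fh a; apply/rowP=> i; rewrite -!coefE fh.
Qed.

Lemma const_row_mulE r t (v : 'rV[k]_r) (D : 'M[S]_(r, t)) j :
  (const_row v *m D) 0 j = \sum_i v 0 i *: D i j.
Proof. by rewrite mxE; apply: eq_bigr => i _; rewrite mxE mul_mpolyC. Qed.

Section Map.
Variables (r t : nat) (s : 'I_r -> nat) (s' : 'I_t -> nat) (D : 'M[S]_(r, t)).
Hypothesis D_homog : forall i j, degree_preserving (s i) (s' j) (D i j).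

(** In the least degree in which the source lives, its elements have constant
    coefficients; the components of [u] of other degrees contribute nothing to
    [y]. *)
Lemma lift_const d (y : 'rV[S]_t) (u : 'rV[S]_r) :
    (forall i, (d <= s i)%N) -> (forall j, degree_preserving d (s' j) (y 0 j)) ->
    y = u *m D ->
  exists2 v, supported s d v & y = const_row v *m D.
Proof.
move=> d_s y_homog y_uD.
exists (\row_i if s i == d then (u 0 i)@_0%MM else 0) => [i /negPf s_i|].
  by rewrite mxE s_i.
apply/rowP=> j; rewrite const_row_mulE; apply/mpolyP=> m; rewrite raddf_sum /=.
have [y_j yE] := (y_homog j, congr1 (fun y : 'rV_t => y 0 j) y_uD).
rewrite /= mxE in yE.
have coefE i : mdeg m = (d - s' j)%N -> (s' j <= d)%N ->
    (u 0 i * D i j)@_m =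
    ((\row_i (if s i == d then (u 0 i)@_0%MM else 0)) 0 i *: D i j)@_m.
  move=> m_d j_d; rewrite mcoeffZ mxE; have := D_homog i j.
  rewrite /degree_preserving (leq_trans j_d (d_s i)) => D_ij.
  case: eqP => [s_i|/eqP s_i]; first by rewrite (mcoeffM_lead _ D_ij) ?s_i.
  rewrite mul0r (mcoeffM_ldegree _ D_ij) // m_d ltn_sub2r ?(leq_ltn_trans j_d) //;
    by rewrite ltn_neqAle eq_sym s_i d_s.
have zeroE i : ((s' j <= d)%N -> mdeg m != (d - s' j)%N) ->
    ((\row_i (if s i == d then (u 0 i)@_0%MM else 0)) 0 i *: D i j)@_m = 0.
  move=> m_d; rewrite mcoeffZ mxE; case: eqP => [s_i|]; last by rewrite mul0r.
  have := D_homog i j; rewrite /degree_preserving s_i; case: ifP => [j_d D_ij|_ /eqP->].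
    by rewrite (dhomog_coef0 D_ij) ?mulr0 ?m_d.
  by rewrite mcoeff0 mulr0.
have [/andP[j_d /eqP m_d]|m_d] := boolP ((s' j <= d)%N && (mdeg m == d - s' j)%N).
  by rewrite yE raddf_sum; apply: eq_bigr => i _; apply: coefE.
rewrite big1 => [|i _]; last by apply: zeroE => j_d; rewrite j_d in m_d.
move: y_j; rewrite /degree_preserving; case: ifP m_d => /= [_ m_d y_j|_ _ /eqP->].
  by rewrite (dhomog_coef0 y_j).
by rewrite mcoeff0.
Qed.

Variables (q : nat) (D' : 'M[S]_(q, r)).
Hypothesis D'_minimal : forall i j, (D' i j)@_0%MM = 0.
Hypothesis D_exact : forall u : 'rV[S]_r, u *m D = 0 -> exists v, u = v *m D'.

(** Kernel elements come from the next map, whose entries have no constant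
    term. *)
Lemma const_row_mul_eq0 (v : 'rV[k]_r) : const_row v *m D = 0 -> v = 0.
Proof.
case/D_exact=> w v_wD'; apply/rowP=> i; rewrite mxE.
have := congr1 (fun y : 'rV[S]_r => (y 0 i)@_0%MM) v_wD'.
rewrite !mxE mcoeffC eqxx mulr1 => ->; rewrite raddf_sum big1 // => j _ /=.
by rewrite (rmorphM (mcoeff 0%MM)) /= D'_minimal mulr0.
Qed.

Hypothesis D_minimal : forall i j, (D i j)@_0%MM = 0.

(** A nonzero entry between basis elements of the same degree would be a
    unit. *)
Lemma degree_preserving0 d i j : (s i <= d)%N -> (d <= s' j)%N -> D i j = 0.
Proof.
move=> i_d d_j; have := D_homog i j; rewrite /degree_preserving.
case: ifP => [j_i|_ /eqP //].
have -> : (s i - s' j)%N = 0%N by lia.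
by move/dhomog0_const=> ->; rewrite D_minimal mpolyC0.
Qed.

(** A basis element in a degree at most [d] would be sent to zero, for lack of
    room in the target. *)
Lemma shift_lower_bound d : (forall j, (d <= s' j)%N) -> forall i, (d < s i)%N.
Proof.
move=> d_s' i; rewrite ltnNge; apply/negP=> s_i.
suff /rowP/(_ i) : delta_mx 0 i = 0 :> 'rV[k]_r.
  by rewrite !mxE !eqxx => /eqP; rewrite oner_eq0.
apply: const_row_mul_eq0; apply/rowP=> j; rewrite const_row_mulE mxE.
rewrite big1 // => i' _; rewrite mxE eqxx /=.
by case: eqP => [->|]; rewrite ?scale0r // (degree_preserving0 s_i) ?scaler0.
Qed.

(** The coefficients at the basis elements of degree [d.+1] vanish by
    minimality, and those at the basis elements of higher degree because the map
    preserves degrees. *)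
Lemma linear_image d (v : 'rV[k]_r) :
    (forall j, (d <= s' j)%N) -> supported s d.+1 v ->
  const_row v *m D = linear_row (fun a => v *m linear_part D a) /\
  forall a, supported s' d (v *m linear_part D a).
Proof.
move=> d_s' v_d.
have entry_homog j : (const_row v *m D) 0 j \is 1.-homog.
  rewrite const_row_mulE; apply: rpred_sum => i _.
  have [s_i|/v_d->] := eqVneq (s i) d.+1; last by rewrite scale0r rpred0.
  have [j_d|j_d] := eqVneq (s' j) d.
    apply: rpredZ; have := D_homog i j.
    by rewrite /degree_preserving s_i j_d leqnSn subSnn.
  rewrite (@degree_preserving0 d.+1) ?scaler0 ?rpred0 ?s_i //.
  by rewrite ltn_neqAle eq_sym j_d d_s'.
have coefE j a : ((const_row v *m D) 0 j)@_U_(a) = (v *m linear_part D a) 0 j.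
  rewrite const_row_mulE raddf_sum mxE; apply: eq_bigr => i _.
  by rewrite /= mcoeffZ mxE.
split=> [|a j j_d].
  apply/rowP=> j; rewrite linear_rowE {1}(linear_form (entry_homog j)).
  by apply: eq_bigr => a _; rewrite coefE.
rewrite mxE big1 // => i _; rewrite mxE.
have [s_i|/v_d->] := eqVneq (s i) d.+1; last by rewrite mul0r.
rewrite (@degree_preserving0 d.+1) ?mcoeff0 ?mulr0 ?s_i //.
by rewrite ltn_neqAle eq_sym j_d d_s'.
Qed.

End Map.
End GradedMaps.

Section LinearStrand.
Variables (k : fieldType) (N : nat).
Local Notation S := {mpoly k[N]}.
Variables (I : {pred S}) (r1 r2 r3 r4 : nat).
Variables (s1 : 'I_r1 -> nat) (s2 : 'I_r2 -> nat) (s3 : 'I_r3 -> nat).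
Variables (d0 : 'cV[S]_r1) (d1 : 'M[S]_(r2, r1)) (d2 : 'M[S]_(r3, r2)).
Variable d3 : 'M[S]_(r4, r3).
Hypothesis d0_homog : forall i, d0 i 0 \is (s1 i).-homog.
Hypothesis d1_homog : forall i j, degree_preserving (s2 i) (s1 j) (d1 i j).
Hypothesis d2_homog : forall i j, degree_preserving (s3 i) (s2 j) (d2 i j).
Hypothesis d1_minimal : forall i j, (d1 i j)@_0%MM = 0.
Hypothesis d2_minimal : forall i j, (d2 i j)@_0%MM = 0.
Hypothesis d3_minimal : forall i j, (d3 i j)@_0%MM = 0.
Hypothesis d0_image : forall p, p \in I <-> exists u : 'rV_r1, p = (u *m d0) 0 0.
Hypothesis d0_exact : forall u : 'rV_r1, u *m d0 = 0 <-> exists v, u = v *m d1.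
Hypothesis d1_exact : forall u : 'rV_r2, u *m d1 = 0 <-> exists v, u = v *m d2.
Hypothesis d2_exact : forall u : 'rV_r3, u *m d2 = 0 <-> exists v, u = v *m d3.
Hypothesis I_ldegree :
  forall p d, p \in I -> p \is d.-homog -> (d < 2)%N -> p = 0.

Definition quadratic_syzygy (P : 'I_N -> 'I_N -> S) : Prop :=
  [/\ forall a b, P a b \in I /\ P a b \is 2.-homog,
      forall a, P a a = 0,
      forall a b, a != b -> P a b + P b a = 0
    & forall a, \sum_b 'X_b * P a b = 0].

Definition strand_syzygy (v : 'rV[k]_r3) (a b : 'I_N) : S :=
  (const_row N (v *m linear_part d2 a *m linear_part d1 b) *m d0) 0 0.

Let d0_homog' i (j : 'I_1) : degree_preserving (s1 i) 0 (d0 i j).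
Proof. by rewrite /degree_preserving leq0n subn0 ord1. Qed.

Let d0_kernel (u : 'rV_r1) : u *m d0 = 0 -> exists v, u = v *m d1.
Proof. by move/d0_exact. Qed.
Let d1_kernel (u : 'rV_r2) : u *m d1 = 0 -> exists v, u = v *m d2.
Proof. by move/d1_exact. Qed.
Let d2_kernel (u : 'rV_r3) : u *m d2 = 0 -> exists v, u = v *m d3.
Proof. by move/d2_exact. Qed.

(** A basis element of degree less than 2 would be sent to an element of [I] of
    that degree. *)
Lemma shift1_ge2 i : (2 <= s1 i)%N.
Proof.
rewrite leqNgt; apply/negP=> s_i.
suff /rowP/(_ i) : delta_mx 0 i = 0 :> 'rV[k]_r1.
  by rewrite !mxE !eqxx => /eqP; rewrite oner_eq0.
have row_i : (const_row N (delta_mx 0 i) *m d0) 0 0 = d0 i 0.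
  rewrite const_row_mulE (bigD1 i) //= mxE !eqxx scale1r big1 ?addr0 // => i'.
  by move=> /negPf i'_i; rewrite mxE eqxx i'_i scale0r.
apply: (const_row_mul_eq0 d1_minimal d0_kernel).
apply/rowP=> j; rewrite ord1 row_i mxE.
apply: I_ldegree (d0_homog i) s_i; apply/d0_image.
by exists (const_row N (delta_mx 0 i)).
Qed.

Lemma shift2_ge3 i : (3 <= s2 i)%N.
Proof.
exact: (shift_lower_bound d1_homog d2_minimal d1_kernel d1_minimal shift1_ge2).
Qed.

Lemma shift3_ge4 i : (4 <= s3 i)%N.
Proof.
exact: (shift_lower_bound d2_homog d3_minimal d2_kernel d2_minimal shift2_ge3).
Qed.

Section OfVector.
Variable v : 'rV[k]_r3.
Hypothesis v_supp : supported s3 4 v.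
Let u a := v *m linear_part d2 a.
Let w a b := u a *m linear_part d1 b.

Lemma strand_image3 :
  const_row N v *m d2 = linear_row u /\ forall a, supported s2 3 (u a).
Proof. exact: (linear_image d2_homog d2_minimal shift2_ge3 v_supp). Qed.

Lemma strand_image2 a :
  const_row N (u a) *m d1 = linear_row (w a) /\ forall b, supported s1 2 (w a b).
Proof.
exact: (linear_image d1_homog d1_minimal shift1_ge2 (strand_image3.2 a)).
Qed.
End OfVector.

Lemma const_row0 r : const_row N (0 : 'rV[k]_r) = 0.
Proof. by apply/rowP=> i; rewrite !mxE mpolyC0. Qed.

Lemma const_rowD r (x y : 'rV[k]_r) :
  const_row N (x + y) = const_row N x + const_row N y.
Proof. by apply/rowP=> i; rewrite !mxE mpolyCD. Qed.

Lemma linear_row_homog r (s : 'I_r -> nat) d (f : 'I_N -> 'rV[k]_r) j :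
  (forall a, supported s d (f a)) -> degree_preserving d.+1 (s j) (linear_row f 0 j).
Proof.
move=> f_supp; rewrite linear_rowE /degree_preserving.
have [s_j|s_j] := eqVneq (s j) d.
  rewrite s_j leqnSn subSnn; apply: rpred_sum => a _.
  by rewrite mulrC mul_mpolyC; apply: rpredZ; rewrite dhomogX /= mdeg1.
rewrite big1 => [|a _]; last by rewrite f_supp // mpolyC0 mulr0.
by rewrite rpred0 eqxx if_same.
Qed.

Lemma linear_row_mul r t (f : 'I_N -> 'rV[k]_r) (D : 'M[S]_(r, t)) :
  linear_row f *m D = \sum_a 'X_a *: (const_row N (f a) *m D).
Proof. by rewrite mulmx_suml; apply: eq_bigr => a _; rewrite scalemxAl. Qed.

Lemma alternating_linear_rows r (f : 'I_N -> 'I_N -> 'rV[k]_r) :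
  \sum_a 'X_a *: linear_row (f a) = 0 <->
  (forall a, f a a = 0) /\ (forall a b, a != b -> f a b + f b a = 0).
Proof.
have entryE i : (\sum_a 'X_a *: linear_row (f a)) 0 i =
    \sum_a 'X_a * \sum_b 'X_b * (f a b 0 i)%:MP.
  by rewrite summxE; apply: eq_bigr => a _; rewrite mxE linear_rowE.
split=> [f0|[f_diag f_alt]].
  have {}f0 i : (forall a, f a a 0 i = 0) /\
      (forall a b, a != b -> f a b 0 i + f b a 0 i = 0).
    by apply/quadratic_eq0; rewrite -entryE f0 mxE.
  split=> [a|a b ab]; apply/rowP=> i; rewrite !mxE.
    exact: (f0 i).1.
  exact: (f0 i).2.
apply/rowP=> i; rewrite entryE mxE; apply/quadratic_eq0.
split=> [a|a b ab]; first by rewrite f_diag mxE.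
by have := congr1 (fun y : 'rV_r => y 0 i) (f_alt a b ab); rewrite !mxE.
Qed.

(** The composite of the first two maps is zero: its coefficients at [X_a X_b]
    give the alternation. The composite of the last two is zero: this gives the
    linear relations. *)
Theorem strand_syzygyP v : supported s3 4 v -> quadratic_syzygy (strand_syzygy v).
Proof.
move=> v_supp; have [d2_v u_supp] := strand_image3 v_supp.
have d1_u a := (strand_image2 v_supp a).1; have w_supp a := (strand_image2 v_supp a).2.
have : \sum_a 'X_a *:
    linear_row (fun b => v *m linear_part d2 a *m linear_part d1 b) = 0.
  under eq_bigr => a _ do rewrite -d1_u.
  by rewrite -linear_row_mul -d2_v; apply/d1_exact; exists (const_row N v).
case/alternating_linear_rows=> w_diag w_alt; split=> [a b|a|a b ab|a].
- split; first by apply/d0_image; eexists.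
  rewrite /strand_syzygy const_row_mulE; apply: rpred_sum => i _.
  have [s_i|/w_supp->] := eqVneq (s1 i) 2; last by rewrite scale0r rpred0.
  by apply: rpredZ; have := d0_homog i; rewrite s_i.
- by rewrite /strand_syzygy w_diag const_row0 mul0mx mxE.
- have := congr1 (fun x => (const_row N x *m d0) 0 0) (w_alt a b ab).
  by rewrite const_rowD mulmxDl const_row0 mul0mx [RHS]mxE [LHS]mxE.
have : const_row N (v *m linear_part d2 a) *m d1 *m d0 = 0.
  by apply/d0_exact; exists (const_row N (v *m linear_part d2 a)).
rewrite d1_u linear_row_mul => /(congr1 (fun x : 'M_1 => x 0 0)).
rewrite summxE mxE => sum0; rewrite -[RHS]sum0.
by apply: eq_bigr => b _; rewrite mxE.
Qed.

(** None of the three maps kills a combination of basis elements with constant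
    coefficients. *)
Theorem strand_syzygy_inj v :
  supported s3 4 v -> (forall a b, strand_syzygy v a b = 0) -> v = 0.
Proof.
move=> v_supp v_0; have [d2_v u_supp] := strand_image3 v_supp.
have d1_u a := (strand_image2 v_supp a).1.
apply: (const_row_mul_eq0 d3_minimal d2_kernel); rewrite d2_v.
rewrite /linear_row big1 // => a _.
suff ->: v *m linear_part d2 a = 0 by rewrite const_row0 scaler0.
apply: (const_row_mul_eq0 d2_minimal d1_kernel); rewrite d1_u.
rewrite /linear_row big1 // => b _.
suff ->: v *m linear_part d2 a *m linear_part d1 b = 0.
  by rewrite const_row0 scaler0.
apply: (const_row_mul_eq0 d1_minimal d0_kernel).
by apply/rowP=> j; rewrite ord1 [RHS]mxE; apply: v_0.
Qed.

(** The quadrics, as elements of [I], lift to the first module; their linear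
    relations lift to the second one; alternation makes the result a relation
    there, which lifts to the third one. Each lift has constant coefficients, as
    it is made in the least degree. *)
Theorem strand_syzygy_surj P :
    quadratic_syzygy P ->
  exists2 v, supported s3 4 v & forall a b, strand_syzygy v a b = P a b.
Proof.
case=> P_I P_diag P_alt P_syz.
have ex_w ab : exists w, supported s1 2 w /\ P ab.1 ab.2 = (const_row N w *m d0) 0 0.
  have [/d0_image[u P_u] P_2] := P_I ab.1 ab.2.
  have [] := lift_const d0_homog' (d := 2) (y := (P ab.1 ab.2)%:M) (u := u) shift1_ge2.
  - by move=> j; rewrite ord1 mxE /degree_preserving subn0.
  - by apply/rowP=> j; rewrite ord1 mxE mulr1n.
  by move=> w w_supp P_w; exists w; split=> //; rewrite -P_w mxE mulr1n.
have [w0 w0P] := fin_all_exists ex_w; pose w a b := w0 (a, b).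
have w_supp a b : supported s1 2 (w a b) by have [] := w0P (a, b).
have PE a b : P a b = (const_row N (w a b) *m d0) 0 0 by have [_ <-] := w0P (a, b).
have d0_w_eq0 x : (const_row N x *m d0) 0 0 = 0 -> x = 0.
  move=> x0; apply: (const_row_mul_eq0 d1_minimal d0_kernel).
  by apply/rowP=> j; rewrite ord1 [RHS]mxE.
have w_alt : (forall a, w a a = 0) /\ (forall a b, a != b -> w a b + w b a = 0).
  split=> [a|a b ab]; apply: d0_w_eq0; first by rewrite -PE P_diag.
  by rewrite const_rowD mulmxDl mxE -!PE P_alt.
have ex_u a : exists u, supported s2 3 u /\ linear_row (w a) = const_row N u *m d1.
  have /d0_exact[u' w_u] : linear_row (w a) *m d0 = 0.
    apply/rowP=> j; rewrite linear_row_mul summxE ord1 mxE -[RHS](P_syz a).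
    by apply: eq_bigr => b _; rewrite mxE PE.
  have [] := lift_const d1_homog (d := 3) (y := linear_row (w a)) (u := u') shift2_ge3.
  - by move=> j; apply: linear_row_homog => b; apply: w_supp.
  - by [].
  by move=> u u_supp w_u'; exists u.
have [u uP] := fin_all_exists ex_u.
have /d1_exact[v' u_v] : linear_row u *m d1 = 0.
  rewrite linear_row_mul; under eq_bigr => a _ do rewrite -(uP a).2.
  exact/alternating_linear_rows.
have [] := lift_const d2_homog (d := 4) (y := linear_row u) (u := v') shift3_ge4.
- by move=> j; apply: linear_row_homog => a; have [] := uP a.
- by [].
move=> v v_supp u_v'; exists v => // a b; rewrite /strand_syzygy PE.
have [d2_v u'_supp] := strand_image3 v_supp.
rewrite d2_v in u_v'; rewrite -(linear_row_inj u_v' a).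
have [d1_u _] := linear_image d1_homog d1_minimal shift1_ge2 (uP a).1.
by rewrite -(uP a).2 in d1_u; rewrite -(linear_row_inj d1_u b).
Qed.

End LinearStrand.

(** * Syzygies of an apolar ideal as solutions of the equations *)

Lemma mcoeff_linear_syzygy (k : fieldType) N (P : 'I_N -> {mpoly k[N]}) b c e :
  (\sum_z 'X_z * P z)@_(U_(b) + (U_(c) + U_(e))) =
    (P b)@_(U_(c) + U_(e)) + ((if c == b then 0 else (P c)@_(U_(b) + U_(e))) +
      (if (e == b) || (e == c) then 0 else (P e)@_(U_(b) + U_(c)))).
Proof.
set m := (U_(b) + _)%MM; have mE z : m z = ((b == z) + ((c == z) + (e == z)))%N.
  by rewrite !mnmDE !mnm1E.
have m_b : (m - U_(b))%MM = (U_(c) + U_(e))%MM by rewrite /m addmC addmK.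
have m_c : (m - U_(c))%MM = (U_(b) + U_(e))%MM.
  by rewrite /m addmA [(U_(b) + U_(c))%MM]addmC -addmA addmC addmK.
have m_e : (m - U_(e))%MM = (U_(b) + U_(c))%MM by rewrite /m addmA addmK.
rewrite raddf_sum /=; under eq_bigr => z _ do rewrite mcoeffXM.
have rest (Q : pred 'I_N) : (forall z, Q z -> [&& z != b, z != c & z != e]) ->
    \sum_(z | Q z) (if m z != 0%N then (P z)@_(m - U_(z)) else 0) = 0.
  move=> Q_z; apply: big1 => z /Q_z /and3P[zb zc ze].
  by rewrite mE ![_ == z]eq_sym (negPf zb) (negPf zc) (negPf ze).
rewrite (bigD1 b) //= mE eqxx /= m_b; congr (_ + _).
have [c_b|c_b] := eqVneq c b.
  have [e_b|e_b] /= := eqVneq e b.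
    by rewrite addr0 rest // => z; rewrite e_b c_b andbb => ->.
  rewrite [in e == c]c_b (negPf e_b) add0r (bigD1 e) //= mE eqxx ?(addn1, addnS) /= m_e.
  by rewrite rest ?addr0 // => z /andP[zb ->]; rewrite c_b zb.
rewrite (bigD1 c) //= mE eqxx addnCA /= m_c; congr (_ + _).
have [e_b|e_b] /= := eqVneq e b.
  by rewrite rest // => z /andP[zb zc]; rewrite e_b zb zc.
have [e_c|e_c] /= := eqVneq e c.
  by rewrite rest // => z /andP[zb zc]; rewrite e_c zb zc.
rewrite (bigD1 e) /= ?e_b // mE eqxx ?(addn1, addnS) /= m_e rest ?addr0 // => z.
by case/andP=> /andP[-> ->] ->.
Qed.

Section SyzygySolutions.
Variables (k : fieldType) (n : nat) (d : int).
Local Notation N := (n * n)%N.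
Local Notation cell := ('I_n * 'I_n)%type.
Local Notation idx c := (mxvec_index c.1 c.2).
Hypothesis d_sqr : d * d = 1.

Let e : k := d%:~R.
Let e_sqr : e * e = 1. Proof. by rewrite /e -intrM d_sqr. Qed.
Local Notation I := (apolar (signed_permanent n e)).

Definition coefficients (P : 'I_N -> 'I_N -> {mpoly k[N]}) (x : quad 'I_n 'I_n) : k :=
  (P (idx x.1.1) (idx x.1.2))@_(U_(idx x.2.1) + U_(idx x.2.2)).

Let idx_eq (c c' : cell) : (idx c == idx c') = (c == c').
Proof. by apply/eqP/eqP => [/cell_index_inj|->]. Qed.

Lemma value1 (q : quad 'I_n 'I_n -> k) x : value q [:: (1, x)] = q x.
Proof. by rewrite value_cons value_nil mul1r addr0. Qed.

(** The equations are read off from the coefficients at the monomials of degree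
    2 and 3. *)
Lemma syzygy_solution P :
  quadratic_syzygy I P -> forall x, solution (syzygy_eqns d x) (coefficients P).
Proof.
case=> P_I P_diag P_alt P_syz [[a b] [c c']] r; rewrite !inE => /or4P[] /eqP->.
- rewrite value_cons mul1r; case: eqP => [ab|/eqP ab].
    by rewrite value_nil addr0 /coefficients /= ab P_diag mcoeff0.
  by rewrite value1 /coefficients /= -mcoeffD P_alt ?mcoeff0 ?idx_eq.
- by rewrite !value_cons value_nil mul1r mulN1r addr0 /coefficients /= addmC subrr.
- have := mcoeff_linear_syzygy (P (idx a)) (idx b) (idx c) (idx c').
  rewrite P_syz mcoeff0 !idx_eq => ->; rewrite value_cons mul1r; congr (_ + _).
  by rewrite /value big_cat /=; do 2?[case: ifP => _];
    rewrite ?big_nil ?big_seq1 ?mul1r.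
- case: ifP => [_|/negbT]; first by rewrite value_nil.
  rewrite negb_or => /andP[c1 c2]; rewrite !value_cons value_nil mul1r addr0.
  have [P_ab P_2] := P_I (idx a) (idx b).
  exact: (iffLR (apolar_quadric e_sqr P_2) P_ab).
Qed.

Lemma solution_syzygy q :
    (forall x, solution (syzygy_eqns d x) q) ->
  exists2 P, quadratic_syzygy I P & coefficients P =1 q.
Proof.
move=> sol_q.
have ex_cell (a : 'I_N) : exists c : cell, idx c = a.
  by case/mxvec_indexP: a => i j; exists (i, j).
have [cl idx_cl] := fin_all_exists ex_cell.
have cl_idx (c : cell) : cl (idx c) = c by apply: cell_index_inj; rewrite idx_cl.
have q_sym a b c c' : q ((a, b), (c, c')) = q ((a, b), (c', c)).
  apply/eqP; rewrite -subr_eq0.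
  have := sol_q ((a, b), (c, c')) [:: (1, ((a, b), (c, c'))); (-1, ((a, b), (c', c)))].
  by rewrite !inE eqxx orbT !value_cons value_nil mul1r addr0 mulN1r => ->.
have ex_P (ab : 'I_N * 'I_N) : exists p : {mpoly k[N]}, p \is 2.-homog /\
    forall i j, p@_(U_(i) + U_(j)) = q ((cl ab.1, cl ab.2), (cl i, cl j)).
  have [p p_2 pE] := quadric_of_coefficients
    (fun i j => q_sym (cl ab.1) (cl ab.2) (cl i) (cl j)).
  by exists p.
have [P0 P0P] := fin_all_exists ex_P; pose P a b := P0 (a, b).
have P_2 a b : P a b \is 2.-homog by have [] := P0P (a, b).
have PE a b i j : (P a b)@_(U_(i) + U_(j)) = q ((cl a, cl b), (cl i, cl j)).
  by have [_ ->] := P0P (a, b).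
exists P => [|[[a b] [c c']]]; last by rewrite /coefficients PE !cl_idx.
have quadric_eq0 (p : {mpoly k[N]}) :
    p \is 2.-homog -> (forall i j, p@_(U_(i) + U_(j)) = 0) -> p = 0.
  move=> p_2 p0; apply: (dhomog_ext p_2) => [|m]; first exact: rpred0.
  case/mnm_mdeg2=> [i [j ->]].
  by rewrite p0 mcoeff0.
split=> [a b|a|a b ab|a].
- split=> //; apply/(apolar_quadric e_sqr (P_2 a b)) => c c' c1 c2.
  have := sol_q ((cl a, cl b), (c, c')) [:: (1, ((cl a, cl b), (c, c')));
    (d, ((cl a, cl b), ((c.1, c'.2), (c'.1, c.2))))].
  rewrite /= !inE (negPf c1) (negPf c2) /= eqxx !orbT => /(_ isT).
  by rewrite !value_cons value_nil mul1r addr0 !PE !cl_idx !(cl_idx (_, _)).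
- apply: quadric_eq0 => // i j; rewrite PE.
  have := sol_q ((cl a, cl a), (cl i, cl j)) _ (mem_head _ _).
  by rewrite eqxx value1.
- apply: quadric_eq0 => [|i j]; first by rewrite rpredD.
  rewrite mcoeffD !PE.
  have := sol_q ((cl a, cl b), (cl i, cl j)) _ (mem_head _ _).
  by rewrite -idx_eq !idx_cl (negPf ab) !value_cons value_nil !mul1r addr0.
- have sum_3 : \sum_b 'X_b * P a b \is 3.-homog.
    by apply: rpred_sum => b _; apply: (dhomogM (d := 1)); rewrite ?dhomogX /= ?mdeg1.
  apply: (dhomog_ext sum_3) => [|m]; first exact: rpred0.
  case/mnm_mdegS=> [b [m' [-> /mnm_mdeg2[c [c' ->]]]]].
  rewrite mcoeff_linear_syzygy mcoeff0 !PE.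
  pose x : quad 'I_n 'I_n := ((cl a, cl b), (cl c, cl c')).
  have := sol_q x _ (@mem_nth _ [::] (syzygy_eqns d x) 2 isT).
  rewrite /= -!idx_eq !idx_cl value_cons mul1r => sum0.
  rewrite -[RHS]sum0; congr (_ + _).
  by rewrite /value big_cat /=; do 2?[case: ifP => _];
    rewrite ?big_nil ?big_seq1 ?mul1r.
Qed.

End SyzygySolutions.

(** * Betti numbers *)

Lemma invertible_dim (k : fieldType) m p (M : 'M[k]_(m, p)) :
    (forall u : 'rV_m, u *m M = 0 -> u = 0) ->
    (forall w : 'rV_p, exists u : 'rV_m, w = u *m M) -> m = p.
Proof.
move=> inj_M surj_M; apply/eqP; rewrite eqn_leq; apply/andP; split.
  have /eqP <-: row_free M; last exact: rank_leq_col.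
  rewrite -kermx_eq0; apply/eqP/row_matrixP => i; rewrite row0.
  by apply: inj_M; rewrite -row_mul mulmx_ker row0.
have /eqP <-: row_full M; last exact: rank_leq_row.
rewrite -sub1mx; apply/row_subP=> i; have [u ->] := surj_M (row i 1%:M).
exact: submxMl.
Qed.

Section Resolution.
Variables (k : fieldType) (N : nat).
Local Notation S := {mpoly k[N]}.
Variable I : {pred S}.
Hypothesis I_const : forall p, p \in I -> p@_0%MM = 0.
Hypothesis I_ldegree :
  forall p d, p \in I -> p \is d.-homog -> (d < 2)%N -> p = 0.
Variable F : free_complex k N.
Hypothesis F_res : minimal_graded_free_resolution I F.

(** The module [F_0] has rank 1. Some basis element must be sent to a nonzero
    constant, because [I] contains no element with a nonzero constant term;
    subtracting a multiple of this one from another basis element gives an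
    element of the kernel with a coefficient equal to 1, against minimality. *)
Lemma rank0_unique : exists a0 : 'I_(rk F 0), exists2 c : k, c != 0 &
  aug F a0 0 = c%:MP /\ forall a, a = a0.
Proof.
have [u I_u] := aug_surj F_res 1.
have [a0 aug_a0] : exists a0, (aug F a0 0)@_0%MM != 0.
  apply/existsP; apply: contraT; rewrite negb_exists => /forallP aug0.
  have /eqP := I_const I_u.
  rewrite mcoeffB mcoeff1 eqxx mxE raddf_sum big1 ?subr0 ?oner_eq0 // => a _.
  have /negPn/eqP a0 := aug0 a.
  by rewrite /= (rmorphM (mcoeff 0%MM)) /= a0 mulr0.
set c := _@__ in aug_a0; have augE : aug F a0 0 = c%:MP.
  apply: dhomog0_const; have := aug_homog F_res a0.
  suff -> : shift a0 = 0%N by [].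
  apply/eqP; apply: contraNT aug_a0 => a0_s; apply/eqP.
  by apply: (dhomog_coef0 (aug_homog F_res a0)); rewrite mdeg0 eq_sym.
exists a0, c => //; split=> // a; apply/eqP; apply: contraT => a_a0.
pose v : 'rV[S]_(rk F 0) := delta_mx 0 a - (c^-1 *: aug F a 0) *: delta_mx 0 a0.
have v_aug : (v *m aug F) 0 0 = 0.
  rewrite mulmxBl -scalemxAl !mxE.
  have deltaE b : \sum_j (delta_mx 0 b : 'rV[S]_(rk F 0)) 0 j * aug F j 0 = aug F b 0.
    rewrite (bigD1 b) //= mxE !eqxx mul1r big1 ?addr0 // => j /negPf j_b.
    by rewrite mxE eqxx j_b mul0r.
  rewrite !deltaE augE mulrC mul_mpolyC scalerA mulfV // scale1r subrr //.
have zero_I : 0 \in I.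
  have := iffRL (aug_exact F_res 0); rewrite mul0mx mxE; apply.
  by exists 0; rewrite mul0mx.
have [] := iffLR (aug_exact F_res v); first by rewrite v_aug.
move=> w /(congr1 (fun y : 'rV_(rk F 0) => (y 0 a)@_0%MM)).
have ->: v 0 a = 1 by rewrite !mxE !eqxx (negPf a_a0) mulr0 subr0.
rewrite mcoeff1 eqxx mxE raddf_sum big1 => [/eqP|b _].
  by rewrite oner_eq0.
by rewrite /= (rmorphM (mcoeff 0%MM)) /= (diff_minimal F_res) mulr0.
Qed.

Let d0 := diff F 0 *m aug F.

Lemma d0_homog i : d0 i 0 \is (shift i).-homog.
Proof.
rewrite mxE; apply: rpred_sum => j _; have := diff_homog F_res i j.
rewrite /degree_preserving; case: leqP => [j_i D_ij|_ /eqP->]; last first.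
  by rewrite mul0r rpred0.
by rewrite -(subnK j_i); apply: dhomogM D_ij (aug_homog F_res j).
Qed.

Lemma d0_image p : p \in I <-> exists u : 'rV_(rk F 1), p = (u *m d0) 0 0.
Proof.
have [a0 [c c_neq0 [augE a0_uniq]]] := rank0_unique.
split=> [p_I | [u ->]]; last first.
  by rewrite mulmxA; apply/(aug_exact F_res); exists u.
pose y : 'rV[S]_(rk F 0) := const_mx (c^-1 *: p).
have y_aug : (y *m aug F) 0 0 = p.
  rewrite mxE (bigD1 a0) //= big1 => [|a /eqP[]]; last exact: a0_uniq.
  by rewrite mxE augE mulrC mul_mpolyC scalerA mulfV // scale1r addr0.
have /(aug_exact F_res)[v y_v] : (y *m aug F) 0 0 \in I by rewrite y_aug.
by exists v; rewrite /d0 mulmxA -y_v y_aug.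
Qed.

Lemma d0_exact (u : 'rV_(rk F 1)) : u *m d0 = 0 <-> exists v, u = v *m diff F 1.
Proof.
have [a0 [c c_neq0 [augE a0_uniq]]] := rank0_unique.
rewrite -(diff_exact F_res) /d0 mulmxA; split=> [y_aug|->]; last by rewrite mul0mx.
apply/rowP=> a; rewrite (a0_uniq a) [RHS]mxE.
have := congr1 (fun M : 'M_1 => M 0 0) y_aug; rewrite mxE [RHS]mxE.
rewrite (bigD1 a0) //= big1 => [|b /eqP[]]; last exact: a0_uniq.
rewrite augE addr0 mulrC mul_mpolyC => /eqP.
by rewrite scaler_eq0 (negPf c_neq0) => /eqP.
Qed.

Let Fhomog i := diff_homog F_res (i := i).
Let Fmin i := diff_minimal F_res (i := i).
Let Fexact i := diff_exact F_res (i := i).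

Definition resolution_syzygy (v : 'rV[k]_(rk F 3)) : 'I_N -> 'I_N -> S :=
  strand_syzygy d0 (diff F 1) (diff F 2) v.

Lemma resolution_syzygyP v :
  supported (@shift _ _ F 3) 4 v -> quadratic_syzygy I (resolution_syzygy v).
Proof.
exact: (strand_syzygyP d0_homog (@Fhomog 1) (@Fhomog 2) (@Fmin 1) (@Fmin 2)
  d0_image d0_exact (@Fexact 1) I_ldegree).
Qed.

Lemma resolution_syzygy_inj v :
    supported (@shift _ _ F 3) 4 v -> (forall a b, resolution_syzygy v a b = 0) ->
  v = 0.
Proof.
exact: (strand_syzygy_inj d0_homog (@Fhomog 1) (@Fhomog 2)
  (@Fmin 1) (@Fmin 2) (@Fmin 3)
  d0_image d0_exact (@Fexact 1) (@Fexact 2) I_ldegree).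
Qed.

Lemma resolution_syzygy_surj P :
    quadratic_syzygy I P ->
  exists2 v, supported (@shift _ _ F 3) 4 v
    & forall a b, resolution_syzygy v a b = P a b.
Proof.
exact: (strand_syzygy_surj d0_homog (@Fhomog 1) (@Fhomog 2)
  (@Fmin 1) (@Fmin 2) (@Fmin 3)
  d0_image d0_exact (@Fexact 1) (@Fexact 2) I_ldegree).
Qed.

Lemma mcoeff_resolution_syzygy a b m :
  exists c : 'cV[k]_(rk F 3), forall v, (resolution_syzygy v a b)@_m = (v *m c) 0 0.
Proof.
exists (linear_part (diff F 2) a *m linear_part (diff F 1) b *m map_mx (mcoeff m) d0).
move=> v; rewrite /resolution_syzygy /strand_syzygy const_row_mulE raddf_sum.
rewrite !mulmxA [RHS]mxE.
by apply: eq_bigr => i _; rewrite /= mcoeffZ [map_mx _ _ _ _]mxE.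
Qed.

End Resolution.

Section Betti.
Variables (k : fieldType) (n : nat) (d : int).
Hypothesis d_sqr : d * d = 1.
Local Notation N := (n * n)%N.
Let e : k := d%:~R.
Let e_sqr : e * e = 1. Proof. by rewrite /e -intrM d_sqr. Qed.
Variable F : free_complex k N.
Hypothesis F_res :
  minimal_graded_free_resolution (apolar (signed_permanent n d%:~R)) F.

Variables (table : nat -> nat -> nat) (two : nat -> nat -> bool).
Hypothesis two_neq0 : forall l m, (l <= n)%N -> (m <= n)%N ->
  two l m -> (2 : k) != 0.
Hypothesis table_certified : all (fun l => all (fun m =>
  certified (two l m) d (table l m) l m) (iota 1 4)) (iota 1 4).

(** Restricting the coefficients of the syzygy of [v] to the free coordinates
    gives a linear bijection from the vectors of degree 4 onto all families of
    values there. *)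
Theorem betti34_sum :
  betti F 3 4 =
    (\sum_(l < 5) \sum_(m < 5) 'C(n, l) * 'C(n, m) *
       (if (0 < l) && (0 < m) then table l m else 0))%N.
Proof.
have I_const := @apolar_mcoeff0 k n e e_sqr.
have I_ldegree := @apolar_ldegree k n e e_sqr.
have two_I l m : (l <= #|'I_n|)%N -> (m <= #|'I_n|)%N -> two l m -> (2 : k) != 0.
  by rewrite card_ord; apply: two_neq0.
have := card_free_quads two_I table_certified; rewrite card_ord => <-.
have [_ free_inj free_ex] := free_quads_coordinates two_I table_certified.
set Xi := free_quads _ _ _ in free_inj free_ex *.
pose B := [set a : 'I_(rk F 3) | shift a == 4%N]; rewrite -[betti F 3 4]/#|B|.
pose Q v := coefficients (resolution_syzygy (F := F) v).
have ex_c x : exists c : 'cV[k]_(rk F 3), forall v, Q v x = (v *m c) 0 0.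
  exact: mcoeff_resolution_syzygy.
have [c cE] := fin_all_exists ex_c.
pose extend (u : 'rV[k]_#|B|) : 'rV[k]_(rk F 3) :=
  \row_a \sum_(i | enum_val i == a) u 0 i.
have extendE u i : extend u 0 (enum_val i) = u 0 i.
  by rewrite mxE (big_pred1 i) // => j; rewrite (inj_eq enum_val_inj).
have extend_supp u : supported (@shift _ _ F 3) 4 (extend u).
  move=> a a_4; rewrite mxE big1 // => i /eqP def_a.
  by have := enum_valP i; rewrite def_a inE (negPf a_4).
pose M := \matrix_(i < #|B|, j < #|Xi|) c (enum_val j) (enum_val i) 0.
have uM u j : (u *m M) 0 j = Q (extend u) (enum_val j).
  rewrite cE !mxE (partition_big (@enum_val _ (mem B)) xpredT) //=.
  apply: eq_bigr => a _; rewrite mxE mulr_suml; apply: eq_bigr => i /eqP def_a.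
  by rewrite mxE def_a.
apply: (invertible_dim (M := M)) => [u uM0|w].
  have Q0 x : Q (extend u) x = 0.
    apply: free_inj => // [y _|y]; last rewrite mem_enum => y_Xi.
      apply: (syzygy_solution d_sqr).
      exact: (resolution_syzygyP I_const I_ldegree F_res (extend_supp u)).
    by rewrite -(enum_rankK_in y_Xi y_Xi) -uM uM0 mxE.
  have u0 : extend u = 0.
    apply: (resolution_syzygy_inj I_const I_ldegree F_res (extend_supp u)) => a b.
    have [syz_I _ _ _] := resolution_syzygyP I_const I_ldegree F_res (extend_supp u).
    apply: (dhomog_ext (syz_I a b).2) => [|m]; first exact: rpred0.
    case/mnm_mdeg2=> i [j ->]; rewrite mcoeff0.
    case/mxvec_indexP: a => a1 a2; case/mxvec_indexP: b => b1 b2.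
    case/mxvec_indexP: i => i1 i2; case/mxvec_indexP: j => j1 j2.
    exact: (Q0 (((a1, a2), (b1, b2)), ((i1, i2), (j1, j2)))).
  by apply/rowP=> i; rewrite -extendE u0 !mxE.
have [q sol_q q_w] := free_ex (fun x => \sum_(j | enum_val j == x) w 0 j).
have [|P P_syz PE] := solution_syzygy d_sqr (q := q); first by move=> x; apply: sol_q.
have [v v_supp vE] := resolution_syzygy_surj I_const I_ldegree F_res P_syz.
exists (\row_i v 0 (enum_val i)); apply/rowP=> j; rewrite uM.
have -> : extend (\row_i v 0 (enum_val i)) = v.
  apply/rowP=> a; have [a_4|a_4] := eqVneq (shift a) 4%N.
    have a_B : a \in B by rewrite inE a_4.
    by rewrite -(enum_rankK_in a_B a_B) extendE mxE.
  by rewrite extend_supp // v_supp.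
have -> x : Q v x = q x by rewrite -PE /Q /coefficients vE.
rewrite q_w ?mem_enum ?enum_valP // (big_pred1 j) // => i.
by rewrite (inj_eq enum_val_inj).
Qed.

End Betti.

(** * The two formulas *)

Lemma det_poly_signed (k : fieldType) n :
  det_poly k n = signed_permanent n (-1 : k).
Proof.
rewrite /det_poly /determinant; apply: eq_bigr => s _.
under eq_bigr => i _ do rewrite mxE.
rewrite mprodXE -mul_mpolyC; congr (_ * _).
by rewrite rmorphXn rmorphN rmorph1.
Qed.

Lemma perm_poly_signed (k : fieldType) n :
  perm_poly k n = signed_permanent n (1 : k).
Proof.
apply: eq_bigr => s _; under eq_bigr => i _ do rewrite mxE.
by rewrite mprodXE expr1n scale1r.
Qed.

Lemma bin_natr n :
  [/\ 'C(n, 2)%:R = n%:R * (n%:R - 1) / 2 :> rat,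
      'C(n, 3)%:R = n%:R * (n%:R - 1) * (n%:R - 2) / 6 :> rat
    & 'C(n, 4)%:R = n%:R * (n%:R - 1) * (n%:R - 2) * (n%:R - 3) / 24 :> rat].
Proof.
elim: n => [|n [IH2 IH3 IH4]]; first by rewrite !bin0n !mul0r.
by rewrite !binS bin1 !natrD IH2 IH3 IH4 -[n.+1]addn1 natrD; split; field.
Qed.

Lemma bin_shift n :
  [/\ 'C(n + 1, 4) = 'C(n, 4) + 'C(n, 3),
      'C(n + 2, 4) = 'C(n, 4) + 2 * 'C(n, 3) + 'C(n, 2)
    & 'C(n + 3, 4) = 'C(n, 4) + 3 * 'C(n, 3) + 3 * 'C(n, 2) + n]%N.
Proof. by rewrite addn1 addn2 addn3 !binS bin1; split; lia. Qed.

Lemma sum_det_table n :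
  (\sum_(l < 5) \sum_(m < 5) 'C(n, l) * 'C(n, m) *
     (if (0 < l) && (0 < m) then det_table l m else 0) =
   6 * 'C(n + 1, 4) * 'C(n + 3, 4) + 9 * 'C(n + 2, 4) ^ 2)%N.
Proof.
have [-> -> ->] := bin_shift n.
rewrite !(big_ord_recl, big_ord0) /= /bump /= /det_table /= bin1.
move: 'C(n, 2) 'C(n, 3) 'C(n, 4) => c2 c3 c4.
by rewrite !(mul0n, muln0, addn0, add0n, muln1); nia.
Qed.

Lemma sum_perm_table n :
  (\sum_(l < 5) \sum_(m < 5) 'C(n, l) * 'C(n, m) *
     (if (0 < l) && (0 < m) then perm_table l m else 0) =
   6 * 'C(n + 1, 4) * 'C(n + 3, 4) + 9 * 'C(n + 2, 4) ^ 2
     + 2 * 'C(n, 2) * 'C(n, 4))%N.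
Proof.
rewrite -sum_det_table.
rewrite !(big_ord_recl, big_ord0) /= /bump /= /perm_table /det_table /= bin1.
move: 'C(n, 2) 'C(n, 3) 'C(n, 4) => c2 c3 c4.
by rewrite !(mul0n, muln0, addn0, add0n, muln1); nia.
Qed.

Theorem proposition6p1 (k : fieldType) (n : nat) (n_gt0 : (0 < n)%N) :
  ((2%N \in [pchar k] -> (n <= 3)%N) ->
   forall F : free_complex k (n * n),
   minimal_graded_free_resolution (apolar (det_poly k n)) F ->
   (betti F 3 4)%:R =
     1 / 192 * (n%:R - 1) * n%:R ^+ 2 * (n%:R + 1) ^+ 2 * (n%:R + 2)
       * (5 * n%:R ^+ 2 + 5 * n%:R - 18) :> rat
   /\ betti F 3 4 =
        (6 * 'C(n + 1, 4) * 'C(n + 3, 4) + 9 * 'C(n + 2, 4) ^ 2)%N)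
  /\
  (forall F : free_complex k (n * n),
   minimal_graded_free_resolution (apolar (perm_poly k n)) F ->
   (betti F 3 4)%:R =
     1 / 192 * (n%:R - 1) * n%:R ^+ 2
       * (5 * n%:R ^+ 5 + 25 * n%:R ^+ 4 + 35 * n%:R ^+ 3
            - 85 * n%:R ^+ 2 + 8 * n%:R - 84) :> rat
   /\ betti F 3 4 =
        (6 * 'C(n + 1, 4) * 'C(n + 3, 4) + 9 * 'C(n + 2, 4) ^ 2
           + 2 * 'C(n, 2) * 'C(n, 4))%N).
Proof.
have [bin2Q bin3Q bin4Q] := bin_natr n; have [bin1S bin2S bin3S] := bin_shift n.
split=> [char2 F F_res | F F_res].
  have two_neq0 l m : (l <= n)%N -> (m <= n)%N -> (4 <= l)%N || (4 <= m)%N ->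
      (2 : k) != 0.
    move=> l_n m_n lm_4; apply/negP=> two0.
    by have : (n <= 3)%N by [apply: char2; rewrite inE]; lia.
  rewrite det_poly_signed -[-1 : k](rmorphN1 intr) in F_res.
  have bettiE :=
    betti34_sum (erefl : (-1) * (-1) = 1 :> int) F_res two_neq0 det_certified.
  rewrite sum_det_table in bettiE; split=> //.
  rewrite bettiE bin1S bin2S bin3S !(natrD, natrM, natrX) bin2Q bin3Q bin4Q.
  by field.
rewrite perm_poly_signed -[1 : k](rmorph1 intr) in F_res.
have two_neq0 l m : (l <= n)%N -> (m <= n)%N -> false -> (2 : k) != 0 by [].
have bettiE :=
  betti34_sum (erefl : 1 * 1 = 1 :> int) F_res two_neq0 perm_certified.
rewrite sum_perm_table in bettiE; split=> //.
rewrite bettiE bin1S bin2S bin3S !(natrD, natrM, natrX) bin2Q bin3Q bin4Q.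
by field.
Qed.
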